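(* Let $(M,g)$ be a connected smooth Riemannian manifold and let $E\in C^1(\operatorname{Sym}^2T^*M)$ satisfy $\operatorname{div}E=0$. Suppose that at every point $E$ is positive definite, negative definite, or zero. Assume that on every compact set the absolute condition number of $E$ is bounded at its nonzero points, i.e. for every compact $K\subset M$ there is $C_K<\infty$ such that at every point of $K$ where $E\ne0$ the condition number of $E$ is at most $C_K$. Then $E$ cannot assume both definite signs: it is not possible that $E$ is positive definite at some point of $M$ and negative definite at some other point of $M$.
   Context: No completeness or compactness of $(M,g)$ is assumed. At a point where $E\neq0$, with eigenvalues $\mu_1,\dots,\mu_n$ relative to $g$, the absolute condition number of $E$ is $\max_i|\mu_i|/\min_i|\mu_i|$. *)

(* Defs.v *)
From HB Require Import structures.
From mathcomp Require Import all_boot all_order all_algebra.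
From mathcomp Require Import all_classical all_reals all_analysis.

Set Implicit Arguments.
Unset Strict Implicit.
Unset Printing Implicit Defensive.

Import Order.TTheory GRing.Theory Num.Theory.
Import numFieldNormedType.Exports.

Local Open Scope classical_set_scope.
Local Open Scope ring_scope.

Section calculus.
Context {R : realType} {n : nat}.
Implicit Types (f : 'rV[R]_n -> R) (U : set 'rV[R]_n).

Definition pderiv (i : 'I_n) f : 'rV[R]_n -> R := 'D_(delta_mx 0 i) f.

(* [U] is meant to be open. *)
Fixpoint Ck (k : nat) U f : Prop :=
  (forall x, U x -> {for x, continuous f}) /\
  if k is k'.+1 then
    forall i, (forall x, U x -> derivable f x (delta_mx 0 i)) /\
              Ck k' U (pderiv i f)
  else True.

Definition Csmooth U f : Prop := forall k, Ck k U f.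

Definition posdef (A : 'M[R]_n) : Prop :=
  forall v : 'rV[R]_n, v != 0 -> 0 < (v *m A *m v^T) 0 0.

Definition negdef (A : 'M[R]_n) : Prop := posdef (- A).

(* Eigenvalues relative to [G]: for a row vector [v],
   v *m (A *m invmx G) = mu *: v iff v *m A = mu *: (v *m G). *)
Definition abs_eigenvalues (G A : 'M[R]_n) : set R :=
  [set `|mu| | mu in [set mu : R | eigenvalue (A *m invmx G) mu]].

(* The set is finite, so that [sup] and [inf] are a maximum and a minimum. *)
Definition cond_number (G A : 'M[R]_n) : R :=
  sup (abs_eigenvalues G A) / inf (abs_eigenvalues G A).

End calculus.

(* A homeomorphism from an open subset of [T] onto an open subset of R^n;
   [coord] and [param] are irrelevant outside [dom] and [coord @` dom]. *)
Record chart (R : realType) (n : nat) (T : topologicalType) := Chart {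
  dom : set T;
  coord : T -> 'rV[R]_n;
  param : 'rV[R]_n -> T;
  dom_open : open dom;
  img_open : open (coord @` dom);
  paramK : forall p, dom p -> param (coord p) = p;
  coord_cont : forall p, dom p -> {for p, continuous coord};
  param_cont : forall x, (coord @` dom) x -> {for x, continuous param};
}.

Definition transition (R : realType) (n : nat) (T : topologicalType)
    (c d : chart R n T) (j : 'I_n) (x : 'rV[R]_n) : R :=
  coord d (param c x) 0 j.

(* The atlas need not be maximal. *)
Record manifold (R : realType) (n : nat) := Manifold {
  carrier :> topologicalType;
  carrier_hausdorff : hausdorff_space carrier;
  carrier_second_countable : @second_countable carrier;
  atlas : set (chart R n carrier);
  atlas_cover : forall p, exists2 c, atlas c & dom c p;
  atlas_smooth : forall c d, atlas c -> atlas d ->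
    forall j, Csmooth (coord c @` (dom c `&` dom d)) (transition c d j);
}.

Section tensors.
Context {R : realType} {n : nat} {M : manifold R n}.

Definition transition_jacobian (c d : chart R n M) (p : M) : 'M[R]_n :=
  \matrix_(i, j) pderiv i (transition c d j) (coord c p).

(* Sections of T^*M (x) T^*M: [comp c p] is the matrix of components at [p]
   in the chart [c], and is irrelevant if [c] is not a chart around [p]. *)
Record tensor2 := Tensor2 {
  comp :> chart R n M -> M -> 'M[R]_n;
  comp_transform : forall c d, atlas c -> atlas d ->
    forall p, dom c p -> dom d p ->
      comp c p = transition_jacobian c d p *m comp d p
                   *m (transition_jacobian c d p)^T;
}.

Implicit Types (T g E : tensor2) (c : chart R n M) (p : M).

Definition in_charts_at p (P : chart R n M -> Prop) : Prop :=
  forall c, atlas c -> dom c p -> P c.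

Definition tensor_sym T : Prop :=
  forall p, in_charts_at p (fun c => (T c p)^T = T c p).

Definition local_comp T c (i j : 'I_n) (x : 'rV[R]_n) : R :=
  T c (param c x) i j.

Definition tensor_Ck (k : nat) T : Prop :=
  forall c, atlas c -> forall i j, Ck k (coord c @` dom c) (local_comp T c i j).

Definition posdef_at T p : Prop := in_charts_at p (fun c => posdef (T c p)).
Definition negdef_at T p : Prop := in_charts_at p (fun c => negdef (T c p)).
Definition zero_at T p : Prop := in_charts_at p (fun c => T c p = 0).

Definition riemannian_metric g : Prop :=
  [/\ tensor_sym g, (forall k, tensor_Ck k g) & forall p, posdef_at g p].

(* g^{ij} at the point of coordinates [x] *)
Definition ginv g c (i j : 'I_n) (x : 'rV[R]_n) : R :=
  invmx (g c (param c x)) i j.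

(* [christoffel g c l i j] is Gamma^l_{ij}. *)
Definition christoffel g c (l i j : 'I_n) (x : 'rV[R]_n) : R :=
  2^-1 * \sum_m ginv g c l m x *
    (pderiv i (local_comp g c j m) x + pderiv j (local_comp g c i m) x
     - pderiv m (local_comp g c i j) x).

(* (nabla_i T)_{jk} for the Levi-Civita connection of [g] *)
Definition cov_deriv g T c (i j k : 'I_n) (x : 'rV[R]_n) : R :=
  pderiv i (local_comp T c j k) x
  - \sum_l christoffel g c l i j x * local_comp T c l k x
  - \sum_l christoffel g c l i k x * local_comp T c j l x.

(* (div T)_k = g^{ij} (nabla_i T)_{jk} *)
Definition divergence g T c (k : 'I_n) (x : 'rV[R]_n) : R :=
  \sum_i \sum_j ginv g c i j x * cov_deriv g T c i j k x.

Definition div_free g T : Prop :=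
  forall p, in_charts_at p (fun c => forall k, divergence g T c k (coord c p) = 0).

Definition cond_le_at g T p (C : R) : Prop :=
  in_charts_at p (fun c => cond_number (g c p) (T c p) <= C).

End tensors.

Arguments tensor2 {R n} M.

(* Main.v *)
Require Import Defs.
From mathcomp Require Import all_boot all_order all_algebra.
From mathcomp Require Import all_classical all_reals all_analysis.
From mathcomp Require Import ring lra.

Set Implicit Arguments.
Unset Strict Implicit.
Unset Printing Implicit Defensive.

Import Order.TTheory GRing.Theory Num.Theory.
Import numFieldNormedType.Exports.

Local Open Scope classical_set_scope.
Local Open Scope ring_scope.

(* Near a zero of [E] all directional derivatives of [E] are again definite or
   zero with controlled condition number, so they are multiples [xi_i L] of one
   definite matrix [L]; the equation [div E = 0] then reads [xi g^-1 L = 0],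
   hence [xi = 0] and the gradient of [E] vanishes at its zeros. Consequently
   [E+], equal to [E] where [E] is positive definite and to [0] elsewhere, is C^1
   and divergence free. Weak unique continuation holds for [E+]: if it vanishes
   near [x0], integrate [div (E+ X)] for the radial field
   [X = (rho^2 - |x - x0|^2)_+^m (x - x0)]. As [E+] is comparable to its trace
   times the identity, for [m] large the term [- 2 m E+(x - x0, x - x0)] makes
   this divergence nonpositive, while its integral is zero; so [E+] vanishes on
   the whole ball, whose radius depends on the centre only locally uniformly.
   The interior of the zero set of [E+] is thus open and closed. It contains the
   points where [E] is negative definite, and by connectedness it is empty or [M].
   The divergence theorem needed here is obtained from Riemann sums on a grid. *)

(** * C^1 functions on open sets of R^n *)

Section row_norm.
Context {R : realType} {n : nat}.
Implicit Types (x : 'rV[R]_n) (e : R).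

Lemma coord_le_norm x i : `|x 0 i| <= `|x|.
Proof.
rewrite [leRHS]/Num.norm /= mx_normrE; apply/bigmax_geP; right => /=.
by exists (0, i).
Qed.

Lemma norm_row_le x e : 0 <= e -> (forall i, `|x 0 i| <= e) -> `|x| <= e.
Proof.
move=> e0 xe; rewrite [leLHS]/Num.norm /= mx_normrE; apply/bigmax_leP; split=> //.
by case=> i j _ /=; rewrite (ord1 i).
Qed.

Lemma norm_row_lt x e : 0 < e -> (forall i, `|x 0 i| < e) -> `|x| < e.
Proof.
move=> e0 xe; rewrite [ltLHS]/Num.norm /= mx_normrE; apply/bigmax_ltP; split=> //.
by case=> i j _ /=; rewrite (ord1 i).
Qed.

Lemma norm_delta_le i : `|delta_mx 0 i : 'rV[R]_n| <= 1.
Proof.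
apply: norm_row_le => // j; rewrite mxE /=.
by case: (_ == _); rewrite ?normr1 ?normr0.
Qed.

End row_norm.

Section calculus.
Context {R : realType} {n : nat}.
Implicit Types (f g th : 'rV[R]_n -> R) (U : set 'rV[R]_n) (x : 'rV[R]_n).

Lemma near_eq_continuous (T S : topologicalType) (f g : T -> S) (x : T) :
  (\forall y \near x, f y = g y) -> {for x, continuous f} ->
  {for x, continuous g}.
Proof.
move=> fg cf; rewrite /prop_for /continuous_at -(nbhs_singleton fg).
by apply: cvg_trans cf; apply: near_eq_cvg; apply: filterS fg.
Qed.

Lemma continuous_sum (T : topologicalType) (I : Type) (s : seq I)
    (F : I -> T -> R) (x : T) :
  (forall i, {for x, continuous (F i)}) ->
  {for x, continuous (fun y => \sum_(i <- s) F i y)}.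
Proof.
move=> cF; elim: s => [|i s IH].
  rewrite (_ : (fun y => _) = cst 0); last first.
    by apply/funext => y; rewrite big_nil.
  exact: cst_continuous.
rewrite (_ : (fun y => _) = (fun y => F i y + \sum_(j <- s) F j y)); last first.
  by apply/funext => y; rewrite big_cons.
by apply: (@continuousD _ R^o _ (F i)) => //; exact: cF.
Qed.

(** The point [y] may leave [K]: continuity is assumed in the ambient space at each point of [K],
    and compactness, in its near-covering form, makes the modulus uniform. *)
Lemma heine (K : set 'rV[R]_n) f (e : R) : compact K ->
  (forall x, K x -> {for x, continuous f}) -> 0 < e ->
  \forall d \near 0^'+, forall x y, K x -> `|x - y| < d -> `|f x - f y| < e.
Proof.
move=> cK cf e0.
have /compact_near_coveringP cov := cK.
suff Kd : \forall d \near 0^'+, K `<=` (fun x =>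
    forall y, `|x - y| < d -> `|f x - f y| < e).
  by apply: filterS Kd => d Kd x y Kx; exact: Kd.
apply: (cov R (0^'+) (fun d x => forall y, `|x - y| < d -> `|f x - f y| < e)).
move=> x Kx.
have /cvgrPdist_lt/(_ (e / 2)) := cf _ Kx.
have e20 : 0 < e / 2 by rewrite divr_gt0.
move=> /(_ e20)/nbhs_ballP[r /= r0 rP].
(* With both radii halved, [y] and [z] lie in the ball of radius [r] around [x], where [f] is within
   [e / 2] of [f x]. *)
exists (ball x (r / 2), [set d | d < r / 2]) => /=.
  split; first by apply: nbhsx_ballx; rewrite divr_gt0.
  by apply: nbhs_right_lt; rewrite divr_gt0.
move=> [y d] /= [xy dr] z yz.
have xy' : ball x r y by apply: le_ball xy; rewrite ler_pdivrMr// ler_pMr//; lra.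
have xz : ball x r z.
  rewrite -ball_normE /= (_ : x - z = (x - y) + (y - z)); last by rewrite addrA subrK.
  rewrite (le_lt_trans (ler_normD _ _))//.
  by move: xy; rewrite -ball_normE /=; lra.
have := rP _ xy'; have := rP _ xz => /= H1 H2.
rewrite (_ : f y - f z = (f x - f z) - (f x - f y)); last by ring.
by rewrite (le_lt_trans (ler_normB _ _))//; lra.
Qed.

Lemma Ck1P U f : Ck 1 U f <-> forall x, U x ->
  {for x, continuous f} /\
  forall i, derivable f x (delta_mx 0 i) /\ {for x, continuous (pderiv i f)}.
Proof.
split=> [[cf df] x Ux|H].
  by split; [exact: cf|move=> i; have [d [c _]] := df i; split; [exact: d|exact: c]].
split; first by move=> x /H[].
move=> i; split; first by move=> x /H[_ /(_ i)[]].
by split=> // x /H[_ /(_ i)[]].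
Qed.

Lemma is_derive_coord x i k :
  is_derive x (delta_mx 0 i) (fun x => x 0 k) (k == i)%:R.
Proof.
apply: DeriveDef.
  by apply: diff_derivable; exact: differentiable_coord.
rewrite /derive; apply: cvg_lim => //.
apply: cvg_near_cst; near=> h.
have h0 : h != 0 by near: h; exact: nbhs_dnbhs_neq.
by rewrite /= !mxE/= addrK -[LHS]/(h^-1 * (h * _)) mulKf.
Unshelve. all: by end_near. Qed.

Lemma is_derive_mul f g x v df dg : is_derive x v f df -> is_derive x v g dg ->
  is_derive x v (fun x => f x * g x) (f x * dg + g x * df).
Proof. by move=> hf hg; exact: is_deriveM. Qed.

Lemma is_derive_exp f x v df k : is_derive x v f df ->
  is_derive x v (fun x => f x ^+ k.+1) (k.+1%:R * f x ^+ k * df).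
Proof.
move=> hf; elim: k => [|k IH].
  by rewrite mul1r expr0 mul1r.
rewrite (_ : (fun x => _) = (fun x => f x * f x ^+ k.+1)); last first.
  by apply/funext => y; rewrite exprS.
apply: is_derive_eq (is_derive_mul hf IH) _.
by rewrite -[k.+2%:R]natr1 exprS; ring.
Qed.

Section on_open.
Variable U : set 'rV[R]_n.
Hypothesis oU : open U.

Let Unear x : U x -> \forall y \near x, U y.
Proof. by move=> Ux; exact: open_nbhs_nbhs. Qed.

(** Openness of [U] is what transfers continuity from the explicit formula [df] to [pderiv], since
    the two agree on a neighbourhood of each point. *)
Lemma Ck1_intro f (df : 'I_n -> 'rV[R]_n -> R) :
  (forall x, U x -> {for x, continuous f}) ->
  (forall x i, U x -> is_derive x (delta_mx 0 i) f (df i x)) ->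
  (forall x i, U x -> {for x, continuous (df i)}) -> Ck 1 U f.
Proof.
move=> cf isd cd; apply/Ck1P => x Ux; split; first exact: cf.
move=> i; split; first by have [] := isd _ i Ux.
apply: near_eq_continuous (cd x i Ux).
apply: filterS (Unear Ux) => y Uy.
by rewrite /pderiv; have [_ <-] := isd _ i Uy.
Qed.

Lemma Ck1_is_derive f : Ck 1 U f ->
  forall x i, U x -> is_derive x (delta_mx 0 i) f (pderiv i f x).
Proof. by move=> /Ck1P H x i /H[_ /(_ i)[d _]]; exact: derivableP. Qed.

Lemma Ck1_eq f g : (forall x, U x -> f x = g x) -> Ck 1 U f -> Ck 1 U g.
Proof.
move=> fg C1; have /Ck1P H := C1.
have nfg x : U x -> \forall y \near x, f y = g y.
  by move=> Ux; apply: filterS (Unear Ux) => y Uy; exact: fg.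
apply: (@Ck1_intro _ (fun i => pderiv i f)) => [x Ux|x i Ux|x i Ux].
- by apply: near_eq_continuous (nfg _ Ux) _; have [] := H _ Ux.
- exact: near_eq_is_derive (nfg _ Ux) (Ck1_is_derive C1 i Ux).
- by have [_ /(_ i)[]] := H _ Ux.
Qed.

Lemma Ck1_cst c : Ck 1 U (fun=> c).
Proof.
apply: (@Ck1_intro _ (fun _ _ => 0)) => *; do ?exact: cst_continuous.
Qed.

Lemma Ck1_add f g : Ck 1 U f -> Ck 1 U g -> Ck 1 U (fun x => f x + g x).
Proof.
move=> cf cg; have /Ck1P Hf := cf; have /Ck1P Hg := cg.
apply: (@Ck1_intro _ (fun i x => pderiv i f x + pderiv i g x)) => [x Ux|x i Ux|x i Ux].
- by apply: (@continuousD _ R^o _ f g); [have [] := Hf _ Ux|have [] := Hg _ Ux].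
- by apply: is_deriveD; exact: Ck1_is_derive.
- apply: (@continuousD _ R^o _ (pderiv i f) (pderiv i g)).
    by have [_ /(_ i)[]] := Hf _ Ux.
  by have [_ /(_ i)[]] := Hg _ Ux.
Qed.

Lemma Ck1_mul f g : Ck 1 U f -> Ck 1 U g -> Ck 1 U (fun x => f x * g x).
Proof.
move=> cf cg; have /Ck1P Hf := cf; have /Ck1P Hg := cg.
apply: (@Ck1_intro _ (fun i x => f x * pderiv i g x + g x * pderiv i f x)) => [x Ux|x i Ux|x i Ux].
- by apply: (@continuousM _ _ f g); [have [] := Hf _ Ux|have [] := Hg _ Ux].
- by apply: is_derive_mul; exact: Ck1_is_derive.
- have [cfx /(_ i)[_ cdf]] := Hf _ Ux; have [cgx /(_ i)[_ cdg]] := Hg _ Ux.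
  apply: (@continuousD _ R^o _ (fun x => f x * pderiv i g x) (fun x => g x * pderiv i f x)).
    exact: (@continuousM _ _ f (pderiv i g) x cfx cdg).
  exact: (@continuousM _ _ g (pderiv i f) x cgx cdf).
Qed.

Lemma Ck1_opp f : Ck 1 U f -> Ck 1 U (fun x => - f x).
Proof.
under [in X in _ -> X]eq_fun do rewrite -mulN1r.
by apply: Ck1_mul; exact: Ck1_cst.
Qed.

Lemma Ck1_inv f : (forall x, U x -> f x != 0) -> Ck 1 U f ->
  Ck 1 U (fun x => (f x)^-1).
Proof.
move=> f0 cf; have /Ck1P Hf := cf.
have cV x : U x -> {for x, continuous (fun x => (f x)^-1)}.
  by move=> Ux; apply: (@continuousV _ _ f); [exact: f0|have [] := Hf _ Ux].
apply: (@Ck1_intro _ (fun i x => - ((f x)^-1 * (f x)^-1) * pderiv i f x)) => [x Ux|x i Ux|x i Ux].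
- exact: cV.
- have [_ /(_ i)[d _]] := Hf _ Ux.
  apply: DeriveDef; first by apply: derivableV => //; exact: f0.
  by rewrite (deriveV (f0 _ Ux) d) -exprVn expr2.
- have [_ /(_ i)[d cdf]] := Hf _ Ux.
  apply: (@continuousM _ _ (fun x => - ((f x)^-1 * (f x)^-1)) (pderiv i f) x _ cdf).
  apply: (@continuousN _ R^o _ (fun x => ((f x)^-1 * (f x)^-1))).
  by apply: (@continuousM _ _ (fun x => (f x)^-1)); exact: cV.
Qed.

Lemma Ck1_sum (I : Type) (s : seq I) (F : I -> 'rV[R]_n -> R) :
  (forall i, Ck 1 U (F i)) -> Ck 1 U (fun x => \sum_(i <- s) F i x).
Proof.
move=> cF; elim: s => [|i s IH].
  by under eq_fun do rewrite big_nil; exact: Ck1_cst.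
rewrite (_ : (fun x => _) = (fun x => F i x + \sum_(j <- s) F j x)).
  exact: (Ck1_add (cF i) IH).
by apply/funext => x; rewrite big_cons.
Qed.

Lemma Ck1_prod (I : Type) (s : seq I) (F : I -> 'rV[R]_n -> R) :
  (forall i, Ck 1 U (F i)) -> Ck 1 U (fun x => \prod_(i <- s) F i x).
Proof.
move=> cF; elim: s => [|i s IH].
  by under eq_fun do rewrite big_nil; exact: Ck1_cst.
rewrite (_ : (fun x => _) = (fun x => F i x * \prod_(j <- s) F j x)).
  exact: (Ck1_mul (cF i) IH).
by apply/funext => x; rewrite big_cons.
Qed.

Lemma Ck1_exp f k : Ck 1 U f -> Ck 1 U (fun x => f x ^+ k).
Proof.
move=> cf; elim: k => [|k IH].
  by under eq_fun do rewrite expr0; exact: Ck1_cst.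
by under eq_fun do rewrite exprS; exact: Ck1_mul.
Qed.

Lemma Ck1_coord k : Ck 1 U (fun x => x 0 k).
Proof.
apply: (@Ck1_intro _ (fun i _ => (k == i)%:R)) => [x Ux|x i Ux|x i Ux].
- exact: coord_continuous.
- exact: is_derive_coord.
- exact: cst_continuous.
Qed.

Lemma Ck1_det m (A : 'rV[R]_n -> 'M[R]_m) :
  (forall i j, Ck 1 U (fun x => A x i j)) -> Ck 1 U (fun x => \det (A x)).
Proof.
move=> cA; rewrite /determinant; apply: Ck1_sum => s.
by apply: Ck1_mul; [exact: Ck1_cst|apply: Ck1_prod => i; exact: cA].
Qed.

(** By the adjugate formula, each entry of the inverse is a polynomial in the entries divided by the
    determinant. *)
Lemma Ck1_invmx m (A : 'rV[R]_n -> 'M[R]_m) i j :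
  (forall x, U x -> A x \in unitmx) ->
  (forall i j, Ck 1 U (fun x => A x i j)) ->
  Ck 1 U (fun x => invmx (A x) i j).
Proof.
move=> uA cA; apply: (@Ck1_eq (fun x => (\det (A x))^-1 * ((-1) ^+ (j + i) *
    \det (row' j (col' i (A x)))))).
  by move=> x Ux; rewrite /invmx uA// !mxE.
apply: Ck1_mul; first apply: Ck1_inv; last apply: Ck1_mul.
- by move=> x /uA; rewrite unitmxE unitfE.
- exact: Ck1_det.
- exact: Ck1_cst.
- apply: Ck1_det => k l; under eq_fun do rewrite !mxE; exact: cA.
Qed.

End on_open.

Lemma Ck1_sub U W f : (W `<=` U) -> Ck 1 U f -> Ck 1 W f.
Proof. by move=> WU /Ck1P H; apply/Ck1P => x /WU; exact: H. Qed.

Lemma is_derive_sumf (I : Type) (s : seq I) (F : I -> 'rV[R]_n -> R) dF x v :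
  (forall i, is_derive x v (F i) (dF i)) ->
  is_derive x v (fun x => \sum_(i <- s) F i x) (\sum_(i <- s) dF i).
Proof.
move=> hF; elim: s => [|i s IH].
  under eq_fun do rewrite big_nil; rewrite big_nil; exact: is_derive_cst.
under eq_fun do rewrite big_cons; rewrite big_cons.
exact: is_deriveD.
Qed.

Lemma is_derive_line f x v (t : R) df : is_derive (t *: v + x) v f df ->
  is_derive t 1 (fun s => f (s *: v + x)) df.
Proof.
case=> d e.
have E : (fun h : R => h^-1 *: (((fun s => f (s *: v + x)) \o shift t) (h *: 1) - f (t *: v + x)))
   = (fun h => h^-1 *: ((f \o shift (t *: v + x)) (h *: v) - f (t *: v + x))).
  apply/funext => h; congr (_ *: (f _ - _)) => /=.
  by rewrite [h%:A]mulr1 scalerDl addrA.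
by apply: DeriveDef; rewrite /derivable /derive E.
Qed.

Lemma mvt_line f x v (h : R) : 0 < h ->
  (forall t : R, 0 <= t <= h -> derivable f (t *: v + x) v) ->
  exists2 s : R, 0 <= s <= h &
    f (h *: v + x) - f x = h * 'D_v f (s *: v + x).
Proof.
move=> h0 dh; pose phi (t : R) := f (t *: v + x).
have dphi (t : R) : t \in `[0, h] -> is_derive t (1 : R) phi ('D_v f (t *: v + x)).
  by rewrite in_itv/= => th; apply: is_derive_line; apply: derivableP; exact: dh.
have cphi : {within `[0, h], continuous phi}.
  apply: continuous_in_subspaceT => t; rewrite inE => /dphi [dt _].
  by apply: differentiable_continuous; exact/derivable1_diffP.
have dphi' (t : R) : t \in `]0, h[ -> is_derive t (1 : R) phi ('D_v f (t *: v + x)).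
  by move=> th; apply: dphi; exact: subset_itv_oo_cc th.
have [s sh E] := MVT_segment (ltW h0) dphi' cphi.
exists s; first by rewrite in_itv/= in sh.
by move: E; rewrite /phi scale0r add0r subr0 mulrC.
Qed.

Lemma mvt_line_signed f x v (h : R) :
  (forall t : R, `|t| <= `|h| -> derivable f (t *: v + x) v) ->
  exists2 s : R, `|s| <= `|h| & f (h *: v + x) - f x = h * 'D_v f (s *: v + x).
Proof.
move=> dh; have [h0|h0|->] := ltgtP h 0.
(* For negative [h] the segment is run from its other endpoint, with length [- h]. *)
- have [|t /andP[t0 th]|s /andP[s0 sh]] := @mvt_line f (h *: v + x) v (- h).
  + by rewrite oppr_gt0.
  + rewrite addrA -scalerDl; apply: dh.
    by rewrite ler_norml (ltr0_norm h0); lra.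
  + rewrite !addrA -!scalerDl addNr scale0r add0r => E; exists (s + h).
      by rewrite ler_norml (ltr0_norm h0); lra.
    by rewrite -opprB E mulNr opprK.
- have [t /andP[t0 th]|s /andP[s0 sh] E] := @mvt_line f x v h h0.
    by apply: dh; rewrite !ger0_norm// ltW.
  by exists s; rewrite // !ger0_norm// ltW.
- by exists 0; rewrite // scale0r add0r subrr mul0r.
Qed.

(** The sign function [th] is kept apart from [f] because all components of a tensor are cut off
    along the positivity set of one function, its trace. *)
Definition pos_restr (th f : 'rV[R]_n -> R) x := if 0 < th x then f x else 0.

Lemma norm_pos_restr th f x : `|pos_restr th f x| <= `|f x|.
Proof. by rewrite /pos_restr; case: ifP; rewrite ?normr0. Qed.

Lemma continuous_pos_restr th f x : {for x, continuous th} ->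
  {for x, continuous f} -> (th x = 0 -> f x = 0) ->
  {for x, continuous (pos_restr th f)}.
Proof.
move=> cth cf th0; have [thx|thx|thx] := ltgtP 0 (th x).
- apply: near_eq_continuous cf.
  have thy : \forall y \near x, th y > 0 by exact: (@cvgr_gt R _ _ _ th _ cth).
  apply: filterS thy => y y0.
  by rewrite /pos_restr y0.
- apply: (@near_eq_continuous _ _ (cst 0)); last exact: cst_continuous.
  have thy : \forall y \near x, th y < 0 by exact: (@cvgr_lt R _ _ _ th _ cth).
  apply: filterS thy => y y0.
  by rewrite /pos_restr ltNge ltW.
- rewrite /prop_for /continuous_at {2}/pos_restr -thx ltxx.
  have fx0 : f x = 0 by apply: th0.
  have fe (e : R) : 0 < e -> \forall y \near x, `|f y| < e.
    by move=> e0; move: cf; rewrite /prop_for /continuous_at fx0 =>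
      /(@cvgr0Pnorm_lt _ R^o _ (nbhs x) _ f)/(_ e e0).
  apply/(@cvgr0Pnorm_lt _ R^o _ (nbhs x) _ (pos_restr th f)) => e /fe.
  by apply: filterS => y; apply: le_lt_trans; exact: norm_pos_restr.
Qed.

(** At a zero of [th], where [f] and its derivative vanish, the difference quotients of the
    truncation are bounded by those of [f] and so tend to zero. Elsewhere the truncation is locally
    [f] or locally 0. *)
Lemma is_derive_pos_restr th f x v : {for x, continuous th} ->
  derivable f x v -> (th x = 0 -> f x = 0 /\ 'D_v f x = 0) ->
  is_derive x v (pos_restr th f) (if 0 < th x then 'D_v f x else 0).
Proof.
move=> cth df th0; have [thx|thx|thx] := ltgtP 0 (th x).
- apply: near_eq_is_derive (derivableP df).
  have thy : \forall y \near x, th y > 0 by exact: (@cvgr_gt R _ _ _ th _ cth).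
  apply: filterS thy => y y0.
  by rewrite /pos_restr y0.
- apply: near_eq_is_derive (is_derive_cst (0 : R) x v).
  have thy : \forall y \near x, th y < 0 by exact: (@cvgr_lt R _ _ _ th _ cth).
  apply: filterS thy => y y0.
  by rewrite /pos_restr ltNge ltW.
- have [fx0 dfx0] := th0 (esym thx).
  have px0 : pos_restr th f x = 0 by rewrite /pos_restr -thx ltxx.
  have H : (fun h : R => h^-1 *: ((pos_restr th f \o shift x) (h *: v) - pos_restr th f x))
      @ 0^' --> (0 : R).
    apply/cvgr0Pnorm_lt => e e0.
    have : (fun h : R => h^-1 *: ((f \o shift x) (h *: v) - f x)) @ 0^' --> 'D_v f x.
      exact: df.
    rewrite dfx0 => /cvgr0Pnorm_lt/(_ e e0); apply: filterS => h /=.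
    rewrite px0 fx0 !subr0 !normrM; apply: le_lt_trans.
    by rewrite ler_wpM2l// norm_pos_restr.
  by apply: DeriveDef; [apply/cvg_ex; exists 0|exact: cvg_lim H].
Qed.

Lemma Ck1_pos_restr U th f : open U -> Ck 1 U f ->
  (forall x, U x -> {for x, continuous th}) ->
  (forall x, U x -> th x = 0 -> f x = 0 /\ forall i, pderiv i f x = 0) ->
  Ck 1 U (pos_restr th f).
Proof.
move=> oU /Ck1P cf cth th0.
apply: (@Ck1_intro _ oU _ (fun i => pos_restr th (pderiv i f))) => [x Ux|x i Ux|x i Ux].
- apply: continuous_pos_restr; [exact: cth|by have [] := cf _ Ux|].
  by move=> /(th0 _ Ux)[].
- apply: is_derive_pos_restr; [exact: cth|by have [_ /(_ i)[]] := cf _ Ux|].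
  by move=> /(th0 _ Ux)[fx dfx]; split; [|exact: dfx].
- apply: continuous_pos_restr; [exact: cth|by have [_ /(_ i)[]] := cf _ Ux|].
  by move=> /(th0 _ Ux)[_ ->].
Qed.

End calculus.

(** * The divergence theorem for nonpositive divergence *)

Lemma compact_closed_ball_row (R : realType) n (x0 : 'rV[R]_n) (r : R) :
  compact [set x | `|x - x0| <= r].
Proof.
apply: bounded_closed_compact.
  exists (`|x0| + r); split; first by rewrite num_real.
  move=> M lM x /= xr; apply: le_trans (ltW lM).
  by rewrite -[x](subrK x0) addrC (le_trans (ler_normD _ _))// lerD2l.
rewrite (_ : mkset _ = (fun x => `|x - x0|) @^-1` [set z | z <= r]) //.
apply: closed_comp; last exact: closed_le.
move=> x _; apply: continuous_comp; last exact: norm_continuous.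
by apply: continuousB; [exact: cvg_id|exact: cst_continuous].
Qed.

Section grid.
Context {R : realType} {n : nat}.
Variables (x0 : 'rV[R]_n) (r : R).
Hypothesis r0 : 0 < r.

Let Q := [set x : 'rV[R]_n | `|x - x0| <= r].

(** The norm of row vectors is the sup norm, so [Q] is a cube of side [2 * r]; the grid consists of
    the lower corners of its cells. *)
Definition grid N (f : {ffun 'I_n -> 'I_N}) : 'rV[R]_n :=
  \row_i (x0 0 i - r + 2 * r * (f i)%:R / N%:R).

Lemma in_cubeP x : Q x <-> forall i, x0 0 i - r <= x 0 i <= x0 0 i + r.
Proof.
split=> [Qx i|H].
  by have := le_trans (coord_le_norm (x - x0) i) Qx; rewrite !mxE ler_distl.
apply: norm_row_le; first exact: ltW.
by move=> i; rewrite !mxE ler_distl.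
Qed.

Lemma grid_coord N (k : nat) : (k <= N)%N ->
  0 <= 2 * r * k%:R / N%:R <= 2 * r.
Proof.
move=> kN; apply/andP; split; first by rewrite !mulr_ge0// ?invr_ge0// ltW.
case: N kN => [|N] kN; first by rewrite invr0 mulr0 mulr_ge0// ltW.
by rewrite ler_pdivrMr// ler_pM2l ?ler_nat// mulr_gt0.
Qed.

Lemma grid_segment_in N (f : {ffun 'I_n -> 'I_N}) i (t : R) :
  0 <= t <= 2 * r / N%:R -> Q (t *: delta_mx 0 i + grid f).
Proof.
move=> /andP[t0 th]; apply/in_cubeP => j; rewrite !mxE /=.
have fN := ltn_ord (f j).
have := grid_coord (ltnW fN); have := grid_coord fN.
have -> : (f j).+1%:R = (f j)%:R + 1 :> R by rewrite natr1.
rewrite mulrDr mulr1 mulrDl.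
by case: (j == i) => /=; rewrite ?mulr1 ?mulr0; lra.
Qed.

Lemma grid_in N (f : {ffun 'I_n -> 'I_N}) : Q (grid f).
Proof.
apply/in_cubeP => j; rewrite !mxE.
by have := grid_coord (ltnW (ltn_ord (f j))); lra.
Qed.

Definition grid_shift N i (f : {ffun 'I_n -> 'I_N}) : {ffun 'I_n -> 'I_N} :=
  [ffun j => if j == i then ordS (f j) else f j].

Lemma grid_shift_inj N i : injective (@grid_shift N i).
Proof.
move=> f g fg; apply/ffunP => j; have := congr1 (fun h : {ffun _} => h j) fg.
by rewrite !ffunE; case: ifP => // _ /(can_inj (@ordSK _)).
Qed.

(* The grid is cyclic in direction [i], the two faces being identified because
   the field vanishes on both. *)
Lemma grid_telescope N i (V : 'rV[R]_n -> R) :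
  (forall x, Q x -> `|x 0 i - x0 0 i| = r -> V x = 0) ->
  \sum_(f : {ffun 'I_n -> 'I_N}) V ((2 * r / N%:R) *: delta_mx 0 i + grid f) =
  \sum_(f : {ffun 'I_n -> 'I_N}) V (grid f).
Proof.
move=> V0; rewrite [RHS](reindex_inj (@grid_shift_inj N i)) /=.
apply: eq_bigr => f _.
have N0 : (0 < N)%N by apply: leq_ltn_trans (ltn_ord (f i)).
have N0' : N%:R != 0 :> R by rewrite pnatr_eq0 -lt0n.
have [fN|fN] := ltnP (f i).+1 N.
  congr V; apply/rowP => j; rewrite !mxE !ffunE /=.
  have [->|ji] /= := eqVneq j i; last by rewrite mulr0 add0r.
  rewrite modn_small//.
  have -> : (f i).+1%:R = (f i)%:R + 1 :> R by rewrite natr1.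
  by field.
have {}fN : (f i).+1 = N by apply/eqP; rewrite eqn_leq fN ltn_ord.
rewrite !V0 //.
- exact: grid_in.
- rewrite !mxE !ffunE eqxx/= fN modnn mulr0 mul0r addr0 addrAC subrr add0r.
  by rewrite normrN gtr0_norm.
- apply: grid_segment_in; rewrite lexx andbT.
  by rewrite !mulr_ge0// ?invr_ge0// ltW.
- rewrite !mxE !eqxx/= mulr1.
  rewrite (_ : _ + _ - _ = r) ?gtr0_norm//.
  have fN' : (f i)%:R + 1 = N%:R :> R by rewrite natr1 fN.
  have -> : (f i)%:R = N%:R - 1 :> R by rewrite -fN' addrK.
  by field.
Qed.

Variables (U : set 'rV[R]_n) (V D : 'I_n -> 'rV[R]_n -> R).
Hypothesis QU : Q `<=` U.
Hypothesis dV : forall i x, U x -> is_derive x (delta_mx 0 i) (V i) (D i x).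
Hypothesis cD : forall i x, U x -> {for x, continuous (D i)}.
Hypothesis V0 : forall i x, Q x -> `|x 0 i - x0 0 i| = r -> V i x = 0.

(** A one-sided discrete divergence theorem. By the mean value theorem, the increment of [V i]
    across a cell is at most [h * (D i + e)] with [D i] taken at the corner, and the increments in
    direction [i] cancel. Summing over the [n] directions gives the bound. *)
Lemma grid_sum_ge e : 0 < e -> \forall d \near 0^'+, forall N, (0 < N)%N ->
  2 * r / N%:R < d ->
  - (e * (N ^ n)%:R) * n%:R <=
    \sum_(f : {ffun 'I_n -> 'I_N}) \sum_i D i (grid f).
Proof.
move=> e0.
have : \forall d \near 0^'+, forall i x y, Q x -> `|x - y| < d ->
    `|D i x - D i y| < e.
  apply: filter_forall => i; apply: heine => //.
    exact: compact_closed_ball_row.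
  by move=> x /QU; exact: cD.
apply: filterS => d Hd N N0 Nd; set h := 2 * r / N%:R in Nd.
have h0 : 0 < h by rewrite divr_gt0// ?ltr0n// mulr_gt0.
rewrite exchange_big /=.
have -> : - (e * (N ^ n)%:R) * n%:R = \sum_(i < n) - (e * (N ^ n)%:R).
  by rewrite sumr_const card_ord mulr_natr.
apply: ler_sum => i _.
have -> : e * (N ^ n)%:R = \sum_(f : {ffun 'I_n -> 'I_N}) e.
  by rewrite sumr_const card_ffun !card_ord mulr_natr.
rewrite -sumrN.
rewrite -subr_ge0 -sumrB -(pmulr_rge0 _ h0) mulr_sumr.
suff : \sum_(f : {ffun 'I_n -> 'I_N}) (V i (h *: delta_mx 0 i + grid f) - V i (grid f)) <=
    \sum_(f : {ffun 'I_n -> 'I_N}) h * (D i (grid f) + e).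
  rewrite sumrB grid_telescope ?subrr; last exact: V0.
  by move/le_trans; apply; apply: ler_sum => f _; rewrite opprK.
apply: ler_sum => f _.
have [t th|s sh ->] := @mvt_line _ _ (V i) (grid f) (delta_mx 0 i) h h0.
  by have [] := dV i (QU (grid_segment_in f i th)).
rewrite ler_pM2l//.
have [_ ->] := dV i (QU (grid_segment_in f i sh)).
have : `|D i (grid f) - D i (s *: delta_mx 0 i + grid f)| < e.
  apply: Hd; first exact: grid_in.
  rewrite opprD addrCA subrr addr0 normrN normrZ; apply: le_lt_trans Nd.
  rewrite ger0_norm; last by case/andP: sh.
  rewrite -[leRHS]mulr1 ler_pM//; [by case/andP: sh|by case/andP: sh|].
  exact: norm_delta_le.
by rewrite ltr_norml; lra.
Qed.

Lemma subcell_ltn m k (j : 'I_m) (q : 'I_k) : (j * k + q < m * k)%N.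
Proof.
have := ltn_ord j; have := ltn_ord q => qk jm.
by apply: (@leq_trans (j.+1 * k)); rewrite ?leq_mul2r ?jm ?orbT// mulSn addnC ltn_add2r.
Qed.

(** Indices of the points of the [m * k] grid that lie in the cell [j] of the coarse [m] grid, [q]
    being the position inside that cell. *)
Definition subcell m k (j : 'I_n -> 'I_m) (q : {ffun 'I_n -> 'I_k}) :
  {ffun 'I_n -> 'I_(m * k)} := [ffun i => Ordinal (subcell_ltn (j i) (q i))].

Lemma subcell_inj m k (j : 'I_n -> 'I_m) : injective (@subcell m k j).
Proof.
move=> q q' /ffunP E; apply/ffunP => i; have := E i.
by rewrite !ffunE => -[/addnI/val_inj].
Qed.

(** The hypothesis places [y] in the coarse cell [j], and the grid point lies in the same cell, of
    side [2 * r / m]. *)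
Lemma subcell_near m k (j : 'I_n -> 'I_m) (q : {ffun 'I_n -> 'I_k}) (y : 'rV[R]_n) :
  (forall i, (j i)%:R <= (y 0 i - x0 0 i + r) / (2 * r) * m%:R < (j i).+1%:R) ->
  `|y - grid (subcell j q)| <= 2 * r / m%:R.
Proof.
move=> jy; apply: norm_row_le.
  by rewrite !mulr_ge0// ?invr_ge0// ltW.
move=> i; rewrite !mxE !ffunE/=.
have m0 : 0 < m%:R :> R by rewrite ltr0n (leq_ltn_trans _ (ltn_ord (j i))).
have k0 : 0 < k%:R :> R by rewrite ltr0n (leq_ltn_trans _ (ltn_ord (q i))).
set t := (y 0 i - x0 0 i + r) / (2 * r) in jy *.
have {jy} := jy i; rewrite -/t => /andP[j1 j2].
have -> : y 0 i = x0 0 i - r + 2 * r * t by rewrite /t; field; rewrite gt_eqF.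
rewrite (_ : _ - _ = 2 * r / m%:R * (t * m%:R - (j i)%:R - (q i)%:R / k%:R)); last first.
  by rewrite natrD !natrM; field; rewrite !gt_eqF.
rewrite normrM gtr0_norm; last by rewrite divr_gt0// mulr_gt0.
rewrite ger_pMr; last by rewrite divr_gt0// mulr_gt0.
have q0 : 0 <= (q i)%:R / k%:R :> R by rewrite mulr_ge0 ?invr_ge0// ltW.
have q1 : (q i)%:R / k%:R <= 1 :> R by rewrite ler_pdivrMr// mul1r ler_nat ltnW.
by move: j2; rewrite -natr1 ler_norml; lra.
Qed.

(** If the divergence were negative at [y], it would be below [- eta] at the grid points of a whole
    coarse cell. These make up the fixed fraction [1 / m ^ n] of every refined grid, so the Riemann
    sums could not come as close to being nonnegative as [grid_sum_ge] requires. *)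
Lemma divergence_eq0 : (forall x, Q x -> \sum_i D i x <= 0) ->
  forall y, `|y - x0| < r -> \sum_i D i y = 0.
Proof.
move=> D0 y yr; apply/eqP; rewrite eq_le.
apply/andP; split; first by apply: D0; exact: ltW.
rewrite leNgt; apply/negP => Dy.
pose eta := - (\sum_i D i y) / 2.
have eta0 : 0 < eta by rewrite divr_gt0// oppr_gt0.
have cS : {for y, continuous (fun x => \sum_i D i x)}.
  by apply: continuous_sum => i; apply: cD; apply: QU; rewrite /Q/= ltW.
have [d0 /= d00 Hd0] : exists2 d0 : R, 0 < d0 &
    forall z, `|y - z| < d0 -> \sum_i D i z < - eta.
  have nS : \forall z \near y, \sum_i D i z < - eta.
    apply: (@cvgr_lt R _ _ _ (fun x => \sum_i D i x) _ cS).
    by rewrite /eta; lra.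
  move: nS => /nbhs_ballP[d0 /= d00 H].
  by exists d0 => // z yz; apply: H; rewrite -ball_normE.
have [m m0 md] : exists2 m, (0 < m)%N & 2 * r / m%:R < d0.
  exists (Num.truncn (2 * r / d0)).+1 => //.
  rewrite ltr_pdivrMr// [ltRHS]mulrC -ltr_pdivrMr//; exact: truncnS_gt.
have jx i : {j : 'I_m | j%:R <= (y 0 i - x0 0 i + r) / (2 * r) * m%:R < j.+1%:R}.
  set t := _ * _.
  have := le_lt_trans (coord_le_norm (y - x0) i) yr.
  rewrite !mxE ltr_norml => /andP[y1 y2].
  have t0 : 0 <= t.
    rewrite !mulr_ge0// ?invr_ge0//; last by rewrite mulr_ge0// ltW.
    by rewrite -lerBlDr sub0r ltW.
  have tm : t < m%:R.
    rewrite /t -[ltRHS]mul1r ltr_pM2r ?ltr0n// ltr_pdivrMr ?mulr_gt0//.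
    lra.
  have := truncn_itv t0 => /andP[t1 t2].
  have jm : (Num.truncn t < m)%N by rewrite -(@ltr_nat R) (le_lt_trans t1).
  by exists (Ordinal jm); rewrite /= t1 t2.
pose j i := sval (jx i).
have mn0 : 0 < (m ^ n)%:R :> R by rewrite ltr0n expn_gt0 m0.
(* The coarse [m] is fixed before [e], and [k] comes last. This choice gives [e * (m * k) ^ n * n =
   eta * k ^ n * n / (n + 1)], strictly less than [eta * k ^ n]. *)
pose e := eta / ((m ^ n)%:R * n.+1%:R).
have e0 : 0 < e by rewrite divr_gt0// mulr_gt0// ltr0n.
have /filter_ex[d [Hd dgt0]] : \forall d \near 0^'+, (forall N, (0 < N)%N ->
  2 * r / N%:R < d ->
  - (e * (N ^ n)%:R) * n%:R <=
    \sum_(f : {ffun 'I_n -> 'I_N}) \sum_i D i (grid f)) /\ 0 < d.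
  apply: filterI; [exact: grid_sum_ge|exact: nbhs_right_gt].
pose k := (Num.truncn (2 * r / d)).+1.
have kd : 2 * r / (m * k)%:R < d.
  rewrite ltr_pdivrMr ?ltr0n ?muln_gt0 ?m0// [ltRHS]mulrC -ltr_pdivrMr//.
  apply: lt_le_trans (truncnS_gt _) _.
  by rewrite ler_nat -/k leq_pmull.
have {Hd} := Hd _ _ kd; rewrite muln_gt0 m0 => /(_ isT).
apply/negP; rewrite -ltNge.
set S := [set @subcell m k j q | q in [set: {ffun 'I_n -> 'I_k}]]%SET.
rewrite (bigID (mem S)) /=.
(* The cells outside the block around [y] contribute nonpositive terms and are dropped. *)
rewrite (@le_lt_trans _ _ (\sum_(f in S) \sum_i D i (grid f)))//.
  by rewrite gerDl sumr_le0// => f _; apply: D0; exact: grid_in.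
rewrite big_imset/=; last by move=> ? ? _ _; exact: subcell_inj.
have /le_lt_trans : \sum_(q in [set: {ffun 'I_n -> 'I_k}]%SET)
   \sum_i D i (grid (subcell j q)) <= - eta * (k ^ n)%:R.
  have -> : - eta * (k ^ n)%:R = \sum_(q in [set: {ffun 'I_n -> 'I_k}]%SET) - eta.
    by rewrite sumr_const cardsT card_ffun !card_ord mulr_natr.
  apply: ler_sum => q _; rewrite ltW// Hd0//.
  apply: le_lt_trans md; apply: subcell_near => i; exact: svalP (jx i).
apply.
rewrite expnMn natrM /e.
rewrite (_ : _ * n%:R = - eta * (k ^ n)%:R * (n%:R / n.+1%:R)); last first.
  by field; rewrite ?gt_eqF//= ?pnatr_eq0 //.
rewrite !mulNr ltrN2 gtr_pMr; last by rewrite mulr_gt0// ltr0n expn_gt0.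
by rewrite ltr_pdivrMr ?ltr0n// mul1r ltr_nat.
Qed.

End grid.

(** * Quadratic forms and condition numbers *)

Section forms.
Context {R : realType} {n : nat}.
Implicit Types (A : 'M[R]_n) (v w : 'rV[R]_n).

Definition qform A v : R := (v *m A *m v^T) 0 0.
(** The squared Euclidean length, needed besides the norm of row vectors, which is the sup norm. *)
Definition sqn v : R := \sum_i v 0 i * v 0 i.

Lemma qformE A v : qform A v = \sum_i v 0 i * \sum_j A i j * v 0 j.
Proof.
rewrite /qform !mxE (eq_bigr (fun j => \sum_i v 0 i * A i j * v 0 j)).
  rewrite exchange_big; apply: eq_bigr => i _ /=; rewrite mulr_sumr.
  by apply: eq_bigr => j _; rewrite mulrA.
by move=> j _; rewrite !mxE mulr_suml.
Qed.

Lemma sqnE v : sqn v = (v *m v^T) 0 0.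
Proof. by rewrite !mxE; apply: eq_bigr => i _; rewrite mxE. Qed.

Lemma sqn_ge0 v : 0 <= sqn v.
Proof. by apply: sumr_ge0 => i _; rewrite -expr2 sqr_ge0. Qed.

Lemma coord_sqr_le_sqn v i : v 0 i ^+ 2 <= sqn v.
Proof.
rewrite /sqn (bigD1 i)//= -expr2 lerDl.
by apply: sumr_ge0 => j _; rewrite -expr2 sqr_ge0.
Qed.

Lemma sqn_eq0 v : sqn v = 0 -> v = 0.
Proof.
move=> v0; apply/rowP => i; rewrite mxE; apply/eqP.
by rewrite -sqrf_eq0 eq_le sqr_ge0 andbT -v0 coord_sqr_le_sqn.
Qed.

Lemma norm_le_sqn v (e : R) : 0 < e -> sqn v < e ^+ 2 -> `|v| < e.
Proof.
move=> e0 ve; apply: norm_row_lt => // i.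
rewrite -(@ltr_pXn2r _ 2) ?nnegrE ?normr_ge0// ?(ltW e0)// real_normK ?num_real//.
by rewrite (le_lt_trans _ ve)// coord_sqr_le_sqn.
Qed.

End forms.

(** * Rayleigh quotients, condition numbers and the cone of controlled forms *)

Section cone.
Context {R : realType} {n : nat}.
Implicit Types (A B G H : 'M[R]_n) (v w : 'rV[R]_n).

Definition bform A v w : R := (v *m A *m w^T) 0 0.

Lemma bformDl A v1 v2 w : bform A (v1 + v2) w = bform A v1 w + bform A v2 w.
Proof. by rewrite /bform !mulmxDl mxE. Qed.

Lemma bformDr A v w1 w2 : bform A v (w1 + w2) = bform A v w1 + bform A v w2.
Proof. by rewrite /bform linearD/= mulmxDr mxE. Qed.

Lemma bformZl A (a : R) v w : bform A (a *: v) w = a * bform A v w.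
Proof. by rewrite /bform -!scalemxAl mxE. Qed.

Lemma bformZr A (a : R) v w : bform A v (a *: w) = a * bform A v w.
Proof. by rewrite /bform linearZ/= -scalemxAr mxE. Qed.

Lemma bformC A v w : A^T = A -> bform A v w = bform A w v.
Proof.
move=> sA; rewrite /bform; have -> : w *m A *m v^T = (v *m A *m w^T)^T.
  by rewrite !trmx_mul trmxK sA mulmxA.
by rewrite [RHS]mxE.
Qed.

Lemma qformD A v w (t : R) : A^T = A ->
  qform A (v + t *: w) = qform A v + 2 * t * bform A v w + t ^+ 2 * qform A w.
Proof.
move=> sA; rewrite -![qform A _]/(bform A _ _).
rewrite !(bformDl, bformDr) !(bformZl, bformZr) (bformC w v sA); ring.
Qed.

Lemma qformZ A (a : R) v : qform A (a *: v) = a ^+ 2 * qform A v.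
Proof. by rewrite -[LHS]/(bform A _ _) bformZl bformZr mulrA -expr2. Qed.

Lemma qformN A v : qform (- A) v = - qform A v.
Proof. by rewrite /qform mulmxN mulNmx mxE. Qed.

Lemma qform0 A : qform A 0 = 0.
Proof. by rewrite /qform !mul0mx mxE. Qed.

Lemma qform_delta A i : qform A (delta_mx 0 i) = A i i.
Proof. by rewrite /qform -rowE trmx_delta -colE !mxE. Qed.

Lemma bform_delta A i j : bform A (delta_mx 0 i) (delta_mx 0 j) = A i j.
Proof. by rewrite /bform -rowE trmx_delta -colE !mxE. Qed.

Lemma qform_eigen A G (mu : R) v :
  v *m A = mu *: (v *m G) -> qform A v = mu * qform G v.
Proof. by rewrite /qform => ->; rewrite -scalemxAl mxE. Qed.

Lemma continuous_qform A : continuous (qform A).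
Proof.
move=> v; rewrite (_ : qform A = fun v => \sum_i v 0 i * \sum_j A i j * v 0 j).
  apply: continuous_sum => i.
  apply: (@continuousM _ _ (fun v : 'rV[R]_n => v 0 i) (fun v : 'rV[R]_n => \sum_j A i j * v 0 j)).
    exact: coord_continuous.
  apply: continuous_sum => j.
  apply: (@continuousM _ _ (fun=> A i j) (fun v : 'rV[R]_n => v 0 j)).
    exact: cst_continuous.
  exact: coord_continuous.
by apply/funext => w; exact: qformE.
Qed.

(** The form is nonnegative at [v - t w] with [w = v B], where the linear term in [t] is
    [- 2 t |w|^2]; a small [t > 0] would make it negative unless [w = 0]. *)
Lemma psd_null B v : B^T = B -> (forall w, 0 <= qform B w) ->
  qform B v = 0 -> v *m B = 0.
Proof.
move=> sB B0 Bv; set w := v *m B; apply: sqn_eq0.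
have bw : bform B v w = sqn w by rewrite sqnE /bform.
(* The minimizing parameter would divide by [qform B w]; adding 1 to the denominator covers the case
   where this vanishes. *)
have : 0 <= qform B (v + (- sqn w / (qform B w + 1)) *: w) by [].
rewrite qformD// Bv add0r bw.
set g := qform B w; set s := sqn w.
have g0 : 0 <= g by exact: B0.
have s0 : 0 <= s by exact: sqn_ge0.
have g1 : 0 < g + 1 by rewrite ltr_wpDl.
rewrite (_ : _ + _ = - (s ^+ 2 * (g + 2) / (g + 1) ^+ 2)); last first.
  by field; rewrite gt_eqF.
rewrite oppr_ge0 pmulr_lle0 ?invr_gt0 ?exprn_gt0// pmulr_lle0; last by rewrite ltr_wpDl.
by move=> H; apply/eqP; rewrite -sqrf_eq0 eq_le H sqr_ge0.
Qed.

Lemma posdef_qform_ge0 G v : posdef G -> 0 <= qform G v.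
Proof.
by move=> pG; have [->|v0] := eqVneq v 0; [rewrite qform0|rewrite ltW// pG].
Qed.

Lemma posdef_unitmx G : posdef G -> G \in unitmx.
Proof.
move=> pG; rewrite -row_free_unit -kermx_eq0; apply/eqP.
apply/row_matrixP => i; rewrite row0; set v := row i _.
have vG : v *m G = 0 by rewrite /v -row_mul mulmx_ker row0.
apply/eqP; apply: contraT => /pG; rewrite vG mul0mx mxE ltxx//.
Qed.

(* The minimum over the unit sphere of the Rayleigh quotient is an
   eigenvalue, because [A - mu G] is positive semidefinite and degenerate. *)
Lemma rayleigh_min A G : (0 < n)%N -> A^T = A -> G^T = G -> posdef G ->
  exists v mu, [/\ v != 0, v *m A = mu *: (v *m G) &
    forall w, mu * qform G w <= qform A w].
Proof.
move=> n0 sA sG pG; pose S := [set v : 'rV[R]_n | `|v| = 1].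
have e_neq0 : delta_mx 0 (Ordinal n0) != 0 :> 'rV[R]_n.
  apply/eqP => /rowP/(_ (Ordinal n0)); rewrite !mxE !eqxx/= => /eqP.
  by rewrite oner_eq0.
have nZ v : v != 0 -> S (`|v|^-1 *: v).
  by move=> v0; rewrite /S/= normrZ normfV normr_id mulVf// normr_eq0.
have S0 : S !=set0 by eexists; exact: nZ e_neq0.
have Sneq0 v : S v -> v != 0.
  by move=> Sv; rewrite -normr_eq0 Sv oner_eq0.
have cS : compact S.
  apply: bounded_closed_compact.
    by exists 1; split => // M M1 x /= ->; exact: ltW.
  rewrite (_ : S = (fun x => `|x|) @^-1` [set 1])//.
  apply: closed_comp; last exact: closed_eq.
  by move=> x _; exact: norm_continuous.
pose f v := qform A v / qform G v.
have cf : {within S, continuous f}.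
  apply: continuous_in_subspaceT => v; rewrite inE => /Sneq0 v0.
  apply: (@continuousM _ _ (qform A) (fun v => (qform G v)^-1)).
    exact: continuous_qform.
  apply: (@continuousV _ _ (qform G)); last exact: continuous_qform.
  by rewrite gt_eqF// pG.
have [v vS fv] := EVT_min_rV S0 cS cf.
have {}vS : S v by rewrite inE in vS.
have v0 := Sneq0 _ vS.
pose mu := f v.
have min w : mu * qform G w <= qform A w.
  have [->|w0] := eqVneq w 0; first by rewrite !qform0 mulr0.
  have := fv _ (mem_set (nZ _ w0)); rewrite -/mu /f !qformZ.
  rewrite -mulf_div divff ?mul1r; last first.
    by rewrite expf_neq0// invr_eq0 normr_eq0.
  by rewrite ler_pdivlMr// pG.
exists v, mu; split => //.
have qB w : qform (A - mu *: G) w = qform A w - mu * qform G w.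
  by rewrite /qform mulmxBr mulmxBl -scalemxAr -scalemxAl !mxE.
have /psd_null : (A - mu *: G)^T = A - mu *: G.
  by rewrite linearB/= linearZ/= sA sG.
move=> /(_ v) H; apply/eqP; rewrite -subr_eq0 scalemxAr -mulmxBr; apply/eqP.
apply: H => [w|]; first by rewrite qB subr_ge0.
by rewrite qB /mu /f divfK ?subrr// gt_eqF// pG.
Qed.

(** Here [lam] is the least eigenvalue of [A] relative to [G], and [- Lam] the greatest, found by
    applying [rayleigh_min] to [- A]. Both are positive and attained, so the condition number is
    their quotient and its bound reads [- Lam <= C * lam]. *)
Lemma cond_number_bounds A G (C : R) : (0 < n)%N -> A^T = A -> G^T = G ->
  posdef G -> posdef A -> cond_number G A <= C ->
  exists2 lam, 0 < lam & forall w,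
    lam * qform G w <= qform A w /\ qform A w <= C * lam * qform G w.
Proof.
move=> n0 sA sG pG pA cC.
have [v [lam [v0 vlam lamP]]] := rayleigh_min n0 sA sG pG.
have sNA : (- A)^T = - A by rewrite linearN/= sA.
have [w [Lam [w0 wLam LamP]]] := rayleigh_min n0 sNA sG pG.
have GU := posdef_unitmx pG.
have eig (x : 'rV[R]_n) mu : x != 0 -> x *m A = mu *: (x *m G) ->
    eigenvalue (A *m invmx G) mu.
  move=> x0 xA; apply/eigenvalueP; exists x => //.
  by rewrite mulmxA xA -scalemxAl mulmxK.
have eigP mu : eigenvalue (A *m invmx G) mu -> lam <= mu <= - Lam.
  move=> /eigenvalueP[x xA x0].
  have {}xA : x *m A = mu *: (x *m G).
    by rewrite scalemxAl -xA mulmxA mulmxKV.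
  have qx := pG _ x0; rewrite -/(qform G x) in qx.
  have := lamP x; have := LamP x; rewrite qformN (qform_eigen xA).
  by move=> H1 H2; apply/andP; split; rewrite -(ler_pM2r qx) ?mulNr; lra.
have lam0 : 0 < lam.
  have := pA _ v0; rewrite -/(qform A v) (qform_eigen vlam).
  by rewrite pmulr_lgt0// pG.
have eLam : eigenvalue (A *m invmx G) (- Lam).
  apply: (eig w) => //; apply: (can_inj opprK).
  by rewrite -mulmxN wLam scaleNr opprK.
have elam := eig _ _ v0 vlam.
set T := abs_eigenvalues G A in cC *.
have Tlam : T lam by exists lam => //; rewrite gtr0_norm.
have TLam : T (- Lam).
  exists (- Lam) => //; rewrite ger0_norm//.
  by case/andP: (eigP _ eLam) => /(le_trans (ltW lam0)).
have Tb x : T x -> lam <= x <= - Lam.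
  move=> [mu /eigP /[dup] /andP[m1 m2] mm <-].
  by rewrite ger0_norm// (le_trans (ltW lam0)).
have infT : inf T = lam.
  apply/eqP; rewrite eq_le; apply/andP; split.
    by apply: ge_inf => //; exists lam => x /Tb/andP[].
  by apply: lb_le_inf; [exists lam|move=> x /Tb/andP[]].
have supT : - Lam <= sup T.
  by apply: ub_le_sup => //; exists (- Lam) => x /Tb/andP[].
have LC : - Lam <= C * lam.
  apply: le_trans supT _; move: cC.
  by rewrite /cond_number -/T infT ler_pdivrMr.
exists lam => // x; split => //.
have := LamP x; rewrite qformN => H.
apply: (@le_trans _ _ (- Lam * qform G x)); first by rewrite mulNr lerNr.
by rewrite ler_wpM2r// posdef_qform_ge0.
Qed.

(** Nonnegativity at [e_i + e_j] and [e_i - e_j] bounds [2 |A i j|] by [A i i + A j j], and each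
    diagonal entry is at most the trace. *)
Lemma entry_le_trace A i j : A^T = A -> (forall v, 0 <= qform A v) ->
  `|A i j| <= \tr A.
Proof.
move=> sA A0.
have d0 k : 0 <= A k k by rewrite -qform_delta.
have dtr k : A k k <= \tr A.
  by rewrite /mxtrace (bigD1 k)//= lerDl sumr_ge0.
have H (t : R) : 0 <= A i i + 2 * t * A i j + t ^+ 2 * A j j.
  by have := A0 (delta_mx 0 i + t *: delta_mx 0 j); rewrite qformD// !qform_delta bform_delta.
have := H 1; have := H (-1); have := dtr i; have := dtr j.
by rewrite expr1n sqrrN expr1n ler_norml; lra.
Qed.

(* Encodes, up to sign and in a closed and homogeneous form, that [A] is
   definite or zero with controlled condition number. *)
Definition in_cone (c : R) A : Prop :=
  (forall i j, `|A i j| <= `|\tr A|) /\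
  (forall v, c * `|\tr A| * sqn v <= `|qform A v|).

Lemma in_coneN c A : in_cone c (- A) -> in_cone c A.
Proof.
move=> [H1 H2]; split=> [i j|v].
  by have := H1 i j; rewrite linearN/= !normrN mxE normrN.
by have := H2 v; rewrite linearN/= qformN !normrN.
Qed.

Lemma in_cone0 c : in_cone c 0.
Proof.
split=> [i j|v]; rewrite mxtrace0 ?mxE normr0// mulr0 mul0r.
exact: normr_ge0.
Qed.

(** From [lam G <= A <= C lam G] follow [\tr A <= C * lam * t] and [A >= lam * k] times the
    Euclidean form; eliminating [lam] leaves the constant [k / (C * t)]. *)
Lemma posdef_in_cone A G (C k t : R) : (0 < n)%N -> A^T = A -> G^T = G ->
  posdef G -> posdef A -> cond_number G A <= C -> 0 < C -> 0 < k -> 0 < t ->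
  (forall v, k * sqn v <= qform G v) -> \tr G <= t ->
  in_cone (k / (C * t)) A.
Proof.
move=> n0 sA sG pG pA cC C0 k0 t0 Gk Gt.
have [lam lam0 lamP] := cond_number_bounds n0 sA sG pG pA cC.
have A0 v : 0 <= qform A v by exact: posdef_qform_ge0.
have trA0 : 0 <= \tr A.
  by apply: sumr_ge0 => i _; rewrite -qform_delta.
split=> [i j|v]; first by rewrite (ger0_norm trA0) entry_le_trace.
rewrite !ger0_norm//.
have trA : \tr A <= C * lam * t.
  apply: (@le_trans _ _ (C * lam * \tr G)).
    rewrite mulr_sumr; apply: ler_sum => i _.
    by have [_] := lamP (delta_mx 0 i); rewrite !qform_delta.
  by rewrite ler_pM2l// mulr_gt0.
apply: (@le_trans _ _ (lam * qform G v)); last by have [] := lamP v.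
apply: (@le_trans _ _ (lam * (k * sqn v))); last by rewrite ler_pM2l.
rewrite mulrA ler_wpM2r ?sqn_ge0//.
rewrite mulrAC ler_pdivrMr ?mulr_gt0//.
rewrite (_ : _ * (C * t) = k * (C * lam * t)); last by ring.
by rewrite ler_pM2l.
Qed.

(** Cauchy-Schwarz, by summing [|v_i| |v_j| <= (v_i^2 + v_j^2) / 2] over all pairs. *)
Lemma norm_sum_sqr_le v : (\sum_i `|v 0 i|) ^+ 2 <= n%:R * sqn v.
Proof.
rewrite expr2 mulr_suml.
apply: (@le_trans _ _ (\sum_i \sum_j (v 0 i ^+ 2 + v 0 j ^+ 2) / 2)).
  apply: ler_sum => i _; rewrite mulr_sumr; apply: ler_sum => j _.
  rewrite -(real_normK (num_real (v 0 i))) -(real_normK (num_real (v 0 j))).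
  rewrite ler_pdivlMr// -subr_ge0.
  rewrite (_ : _ - _ = (`|v 0 i| - `|v 0 j|) ^+ 2); last by ring.
  exact: sqr_ge0.
have E : \sum_i v 0 i ^+ 2 = sqn v by apply: eq_bigr => i _; rewrite expr2.
under eq_bigr => i _ do rewrite -mulr_suml big_split/= E sumr_const card_ord.
rewrite -mulr_suml big_split/= sumr_const card_ord sumrMnl E.
by rewrite -[_ *+ n]mulr_natl; lra.
Qed.

Lemma qform_le A (h : R) v : 0 <= h -> (forall i j, `|A i j| <= h) ->
  qform A v <= h * n%:R * sqn v.
Proof.
move=> h0 Ah; apply: (@le_trans _ _ (h * (\sum_i `|v 0 i|) ^+ 2)).
  rewrite qformE expr2 mulrCA mulr_suml; apply: ler_sum => i _.
  apply: le_trans (ler_norm _) _; rewrite normrM ler_wpM2l//.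
  apply: le_trans (ler_norm_sum _ _ _) _.
  rewrite mulr_sumr; apply: ler_sum => j _.
  by rewrite normrM ler_wpM2r.
by rewrite -mulrA ler_wpM2l ?norm_sum_sqr_le.
Qed.

Lemma sqn_mulmx_le A (h : R) v : 0 <= h -> (forall i j, `|A i j| <= h) ->
  sqn (v *m A) <= h ^+ 2 * n%:R ^+ 2 * sqn v.
Proof.
move=> h0 Ah; have H j : (v *m A) 0 j * (v *m A) 0 j <= h ^+ 2 * n%:R * sqn v.
  rewrite -expr2 -real_normK ?num_real//.
  apply: (@le_trans _ _ ((h * \sum_i `|v 0 i|) ^+ 2)).
    rewrite ler_pXn2r ?nnegrE ?mulr_ge0 ?sumr_ge0//.
    rewrite mxE mulr_sumr; apply: le_trans (ler_norm_sum _ _ _) _.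
    by apply: ler_sum => i _; rewrite normrM mulrC ler_wpM2r.
  by rewrite exprMn -mulrA ler_wpM2l ?sqr_ge0// norm_sum_sqr_le.
apply: le_trans (ler_sum _ (fun j _ => H j)) _.
rewrite sumr_const card_ord -mulr_natl le_eqVlt; apply/orP; left; apply/eqP; ring.
Qed.

(* Evaluate the form of [G] at [v - t v G^-1] with the optimal [t]. *)
Lemma qform_ge_of_inv G (k : R) v : G^T = G -> posdef G -> 0 < k ->
  (forall w, qform (invmx G) w <= k * sqn w) -> k^-1 * sqn v <= qform G v.
Proof.
move=> sG pG k0 Hk; have GU := posdef_unitmx pG.
have sH : (invmx G)^T = invmx G by rewrite trmx_inv sG.
have := posdef_qform_ge0 (v + (- k^-1) *: (v *m invmx G)) pG.
rewrite qformD//.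
have -> : bform G v (v *m invmx G) = sqn v.
  by rewrite /bform trmx_mul sH mulmxA mulmxK// sqnE.
have -> : qform G (v *m invmx G) = qform (invmx G) v.
  by rewrite /qform mulmxKV// trmx_mul sH mulmxA.
have := Hk v; set q := qform (invmx G) v; set s := sqn v => qs.
have : k^-1 ^+ 2 * q <= k^-1 * s.
  rewrite expr2 -mulrA ler_pM2l ?invr_gt0//.
  by rewrite mulrC ler_pdivrMr// mulrC.
rewrite sqrrN; lra.
Qed.

End cone.

(** * Weak unique continuation *)

Section wucp.
Context {R : realType} {n : nat}.
Variables (U : set 'rV[R]_n) (x0 : 'rV[R]_n) (P : 'rV[R]_n -> 'M[R]_n).
Variables (u : 'rV[R]_n -> R) (a b rho eps : R).
Hypotheses (oU : open U) (QU : [set x | `|x - x0| <= rho] `<=` U).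
Hypotheses (rho0 : 0 < rho) (eps0 : 0 < eps) (a0 : 0 < a) (b0 : 0 <= b).
Hypothesis P_C1 : forall i j, Ck 1 U (fun x => P x i j).
Hypothesis u_ge0 : forall x, U x -> 0 <= u x.
Hypothesis P_ge : forall x w, U x -> a * u x * sqn w <= qform (P x) w.
Hypothesis trP_le : forall x, U x -> \tr (P x) <= b * u x.
Hypothesis divP_le : forall x j, U x ->
  `|\sum_i pderiv i (fun y => P y i j) x| <= b * u x.
Hypothesis u_eq0 : forall x, U x -> sqn (x - x0) < eps -> u x = 0.

Let th (x : 'rV[R]_n) := rho ^+ 2 - sqn (x - x0).
Let Y (i : 'I_n) (x : 'rV[R]_n) := \sum_j P x i j * (x 0 j - x0 0 j).
(** The exponent [m + 2] makes the field and its first derivatives vanish on the sphere [th = 0]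
    even for [m = 0], so that its truncation to [th > 0] is still C^1. *)
Let F m (i : 'I_n) (x : 'rV[R]_n) := th x ^+ m.+2 * Y i x.

Let is_derive_y x i j :
  is_derive x (delta_mx 0 i) (fun x : 'rV[R]_n => x 0 j - x0 0 j) (j == i)%:R.
Proof.
have H := is_deriveB (is_derive_coord x i j)
  (is_derive_cst (x0 0 j) x (delta_mx 0 i)).
by apply: is_derive_eq H _; rewrite subr0.
Qed.

Let thE : th = fun x => rho ^+ 2 - \sum_j (x 0 j - x0 0 j) * (x 0 j - x0 0 j).
Proof.
by apply/funext => x; congr (_ - _); apply: eq_bigr => i _; rewrite !mxE.
Qed.

Let is_derive_th x i :
  is_derive x (delta_mx 0 i) th (- (2 * (x 0 i - x0 0 i))).
Proof.
rewrite thE.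
have H := is_deriveB (is_derive_cst (rho ^+ 2) x (delta_mx 0 i))
  (is_derive_sumf (index_enum 'I_n) (fun j => is_derive_mul (is_derive_y x i j) (is_derive_y x i j))).
apply: is_derive_eq H _.
rewrite sub0r (bigD1 i)//= eqxx big1 ?addr0; first by rewrite mulr1 mulr2n mulrDl mul1r.
by move=> j /negPf ->; rewrite mulr0 addr0.
Qed.

Let Y_C1 i : Ck 1 U (Y i).
Proof.
apply: Ck1_sum => // j; apply: Ck1_mul => //.
by apply: Ck1_add => //; [exact: Ck1_coord|exact: Ck1_cst].
Qed.

Let is_derive_Y x i : U x -> is_derive x (delta_mx 0 i) (Y i)
  (P x i i + \sum_j pderiv i (fun y => P y i j) x * (x 0 j - x0 0 j)).
Proof.
move=> Ux.
have H := is_derive_sumf (index_enum 'I_n) (fun j => is_derive_mul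
  (Ck1_is_derive (P_C1 i j) i Ux) (is_derive_y x i j)).
apply: is_derive_eq H _.
rewrite big_split/= (bigD1 i)//= eqxx mulr1 big1 ?addr0.
  by congr (_ + _); apply: eq_bigr => j _; rewrite mulrC.
by move=> j /negPf ->; rewrite mulr0.
Qed.

Let th_C1 : Ck 1 U th.
Proof.
rewrite thE; apply: Ck1_add => //; first exact: Ck1_cst.
apply: Ck1_opp => //; apply: Ck1_sum => // j; apply: Ck1_mul => //;
  by apply: Ck1_add => //; [exact: Ck1_coord|exact: Ck1_cst].
Qed.

Let F_C1 m i : Ck 1 U (F m i).
Proof. by rewrite /F; apply: Ck1_mul => //; apply: Ck1_exp. Qed.

Let pderivF m i x : U x -> pderiv i (F m i) x =
  th x ^+ m.+1 * (th x * (P x i i + \sum_j pderiv i (fun y => P y i j) x * (x 0 j - x0 0 j))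
     - 2 * m.+2%:R * ((x 0 i - x0 0 i) * Y i x)).
Proof.
move=> Ux; have [_] := is_derive_mul (is_derive_exp m.+1 (is_derive_th x i)) (is_derive_Y i Ux).
rewrite /pderiv => ->; rewrite exprS; ring.
Qed.

Let pderivF_eq0 m i k x : U x -> th x = 0 -> pderiv k (F m i) x = 0.
Proof.
move=> Ux thx; have [_] := is_derive_mul (is_derive_exp m.+1 (is_derive_th x k)) (Ck1_is_derive (Y_C1 i) k Ux).
by rewrite /pderiv => ->; rewrite thx !expr0n/= !(mulr0,mul0r) addr0.
Qed.

Let divF m x : U x -> \sum_i pderiv i (F m i) x =
  th x ^+ m.+1 * (th x * (\tr (P x) +
      \sum_j (\sum_i pderiv i (fun y => P y i j) x) * (x 0 j - x0 0 j))
     - 2 * m.+2%:R * qform (P x) (x - x0)).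
Proof.
move=> Ux; rewrite (eq_bigr _ (fun i _ => pderivF m i Ux)) -mulr_sumr; congr (_ * _).
rewrite sumrB -!mulr_sumr big_split/= exchange_big/=; congr (_ * (_ + _) - _).
  by apply: eq_bigr => j _; rewrite mulr_suml.
congr (_ * _); rewrite qformE; apply: eq_bigr => i _; rewrite !mxE; congr (_ * _).
by apply: eq_bigr => j _; rewrite !mxE.
Qed.

(* For [m] large the weight [(rho^2 - |x - x0|^2)^m] decreases so fast along the
   radius that the gradient term dominates, except near the centre, where [u]
   vanishes. *)
Let divF_le m x : U x -> `|x - x0| <= rho -> 0 < th x ->
  \sum_i pderiv i (F m i) x <= th x ^+ m.+1 * u x *
    (rho ^+ 2 * (b + n%:R * b * rho) - 2 * m.+2%:R * a * sqn (x - x0)).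
Proof.
move=> Ux xr thx; rewrite divF// -[leRHS]mulrA ler_pM2l ?exprn_gt0//.
rewrite mulrBr lerB//; last first.
  have := P_ge (x - x0) Ux => H.
  rewrite (_ : u x * _ = 2 * m.+2%:R * (a * u x * sqn (x - x0))); last by ring.
  by rewrite ler_wpM2l// mulr_ge0.
have thr : th x <= rho ^+ 2 by rewrite gerDl oppr_le0 sqn_ge0.
have H : \tr (P x) + \sum_j (\sum_i pderiv i (fun y => P y i j) x) * (x 0 j - x0 0 j)
   <= u x * (b + n%:R * b * rho).
  rewrite mulrDr lerD//; first by rewrite mulrC trP_le.
  have -> : u x * (n%:R * b * rho) = \sum_(j < n) b * u x * rho.
    by rewrite sumr_const card_ord -mulr_natr; ring.
  apply: ler_sum => j _; apply: le_trans (ler_norm _) _; rewrite normrM.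
  apply: ler_pM => //; first exact: divP_le.
  by have := le_trans (coord_le_norm (x - x0) j) xr; rewrite !mxE.
have ub : 0 <= u x * (b + n%:R * b * rho).
  by rewrite mulr_ge0 ?u_ge0// addr_ge0// !mulr_ge0// ltW.
rewrite mulrCA.
apply: le_trans (ler_wpM2l (ltW thx) H) _.
by rewrite ler_wpM2r.
Qed.

(** The truncated field is supported in the Euclidean ball inscribed in the cube and vanishes on the
    faces. Its divergence is nonpositive by [divF_le], hence zero inside; at a point where the
    bracket in [divF_le] is negative this forces [u] to vanish. *)
Lemma weak_unique_continuation x : sqn (x - x0) < rho ^+ 2 -> u x = 0.
Proof.
move=> xr; have xrho := norm_le_sqn rho0 xr.
have Ux : U x by apply: QU; exact: ltW.
have [xe|xe] := ltP (sqn (x - x0)) eps; first exact: u_eq0.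
have thx : 0 < th x by rewrite subr_gt0.
(* This [m] makes the bracket of [divF_le] negative at Euclidean distance at least the square root
   of [eps] from the centre; closer in, [u] is zero. *)
pose m := Num.truncn (rho ^+ 2 * (b + n%:R * b * rho) / (2 * a * eps)).
have mP : rho ^+ 2 * (b + n%:R * b * rho) < 2 * m.+2%:R * a * eps.
  rewrite (_ : 2 * _ * _ * _ = m.+2%:R * (2 * a * eps)); last by ring.
  rewrite -ltr_pdivrMr ?mulr_gt0//.
  by apply: lt_trans (truncnS_gt _) _; rewrite ltr_nat.
have neg y : eps <= sqn (y - x0) ->
   rho ^+ 2 * (b + n%:R * b * rho) - 2 * m.+2%:R * a * sqn (y - x0) < 0.
  move=> ye; rewrite subr_lt0 (lt_le_trans mP)// ler_wpM2l//.
  by rewrite !mulr_ge0// ltW.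
have cth y : U y -> {for y, continuous th}.
  by move=> Uy; have /Ck1P/(_ _ Uy)[] := th_C1.
have Fth y : U y -> th y = 0 -> forall i, F m i y = 0 /\ forall k, pderiv k (F m i) y = 0.
  move=> Uy thy i; split; first by rewrite /F thy expr0n mul0r.
  by move=> k; exact: pderivF_eq0.
have := @divergence_eq0 R n x0 rho rho0 U (fun i => pos_restr th (F m i))
  (fun i => pos_restr th (pderiv i (F m i))) QU.
have sumE y : \sum_i pos_restr th (pderiv i (F m i)) y =
    if 0 < th y then \sum_i pderiv i (F m i) y else 0.
  rewrite /pos_restr; case: ifP => // _; exact: big1.
move=> /(_ _ _ _ _ _ xrho)/wrap[||||]; rewrite ?sumE ?thx.
- move=> i y Uy; have /Ck1P/(_ _ Uy)[_ /(_ i)[d _]] := F_C1 m i.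
  apply: is_derive_pos_restr => //; first exact: cth.
  by move=> /(Fth _ Uy)/(_ i)[-> dF]; split => //; exact: dF.
- move=> i y Uy; have /Ck1P/(_ _ Uy)[_ /(_ i)[_ c]] := F_C1 m i.
  apply: continuous_pos_restr => //; first exact: cth.
  by move=> /(Fth _ Uy)/(_ i)[_ dF].
(* On a face of the cube one coordinate of [y - x0] has absolute value [rho], so [th y <= 0]. *)
- move=> i y yQ yi; rewrite /pos_restr ifF//; apply/negbTE; rewrite -leNgt.
  rewrite subr_le0 -yi real_normK ?num_real//.
  by have := coord_sqr_le_sqn (y - x0) i; rewrite !mxE.
- move=> y yQ; rewrite sumE; case: ifP => // thy.
  have Uy := QU yQ; apply: le_trans (divF_le m Uy yQ thy) _.
  have [ye|ye] := ltP (sqn (y - x0)) eps; first by rewrite u_eq0// mulr0 mul0r.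
  apply: mulr_ge0_le0; last by rewrite ltW// neg.
  by rewrite mulr_ge0 ?u_ge0// exprn_ge0// ltW.
- move=> S0; have := divF_le m Ux (ltW xrho) thx; rewrite S0.
  rewrite nmulr_lge0 ?neg// pmulr_rle0 ?exprn_gt0// => ux0.
  by apply/eqP; rewrite eq_le ux0 u_ge0.
Qed.

End wucp.

(** * Zeros of a divergence-free tensor *)

Section gradient.
Context {R : realType} {n : nat}.
Implicit Types (x : 'rV[R]_n).

(** C^1 is defined by partial derivatives only, so the directional derivative is found by going
    first along [i], then along [k], with the mean value theorem on each leg and continuity of the
    partials at [x]. *)
Lemma cvg_two_directions (U : set 'rV[R]_n) (f : 'rV[R]_n -> R) x i k (a b : R) :
  open U -> Ck 1 U f -> U x ->
  (fun t : R => t^-1 * (f (t *: (a *: delta_mx 0 i + b *: delta_mx 0 k) + x) - f x))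
    @ 0^'+ --> a * pderiv i f x + b * pderiv k f x.
Proof.
move=> oU /Ck1P Hf Ux; apply/(@cvgrPdist_lt _ R^o _ (0^'+)) => e e0.
pose c := `|a| + `|b| + 1.
have c0 : 0 < c by rewrite ltr_wpDl// addr_ge0.
have cpd j : \forall y \near x, `|pderiv j f x - pderiv j f y| < e / c.
  have [_ /(_ j)[_ cj]] := Hf _ Ux.
  by move: cj => /(@cvgrPdist_lt _ R^o _ (nbhs x) _ (pderiv j f)); apply; rewrite divr_gt0.
have : \forall y \near x, [/\ U y, `|pderiv i f x - pderiv i f y| < e / c &
    `|pderiv k f x - pderiv k f y| < e / c].
  by apply: filterS3 (open_nbhs_nbhs (conj oU Ux)) (cpd i) (cpd k) => y; split.
move=> /nbhs_ballP[d /= d0 dP].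
have dP' s s' : `|s| + `|s'| < d -> [/\ U (s *: delta_mx 0 k + (s' *: delta_mx 0 i + x)),
    `|pderiv i f x - pderiv i f (s *: delta_mx 0 k + (s' *: delta_mx 0 i + x))| < e / c &
    `|pderiv k f x - pderiv k f (s *: delta_mx 0 k + (s' *: delta_mx 0 i + x))| < e / c].
  move=> ssd; apply: dP; rewrite -ball_normE /= distrC addrA addrK.
  apply: le_lt_trans (ler_normD _ _) _; rewrite !normrZ; apply: le_lt_trans ssd.
  by rewrite lerD// ler_piMr// norm_delta_le.
near=> t.
have t0 : 0 < t by near: t; exact: nbhs_right_gt.
have tc : t * c < d.
  by rewrite -ltr_pdivlMr//; near: t; apply: nbhs_right_lt; rewrite divr_gt0.
have tabd : t * `|a| + t * `|b| < d.
  apply: lt_trans tc; rewrite -mulrDr ltr_pM2l// /c; lra.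
have nt z : `|t * z| = t * `|z| by rewrite normrM gtr0_norm.
have ta0 : 0 <= t * `|a| by rewrite mulr_ge0// ltW.
have tb0 : 0 <= t * `|b| by rewrite mulr_ge0// ltW.
have [s' |s1 s1a E1] := @mvt_line_signed _ _ f x (delta_mx 0 i) (t * a).
  move=> s'a; have [] := dP' 0 s'.
    rewrite normr0 add0r; apply: le_lt_trans s'a _; rewrite nt; lra.
  by rewrite scale0r add0r => Us _ _; have [_ /(_ i)[]] := Hf _ Us.
have [s' |s2 s2b E2] := @mvt_line_signed _ _ f ((t * a) *: delta_mx 0 i + x) (delta_mx 0 k) (t * b).
  move=> s'b; have [|Us _ _] := dP' s' (t * a).
    by apply: le_lt_trans (_ : _ <= t * `|b| + t * `|a|) _; [rewrite -!nt lerD2r|lra].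
  by have [_ /(_ k)[]] := Hf _ Us.
have {dP'} [d1 d2] : `|pderiv i f x - pderiv i f (s1 *: delta_mx 0 i + x)| < e / c /\
   `|pderiv k f x - pderiv k f (s2 *: delta_mx 0 k + ((t * a) *: delta_mx 0 i + x))| < e / c.
  split.
    have [|_] := dP' 0 s1; last by rewrite scale0r add0r.
    by rewrite normr0 add0r; apply: le_lt_trans s1a _; rewrite nt; lra.
  have [|_ _] // := dP' s2 (t * a).
  by apply: le_lt_trans (_ : _ <= t * `|b| + t * `|a|) _; [rewrite -!nt lerD2r|lra].
have -> : t *: (a *: delta_mx 0 i + b *: delta_mx 0 k) + x =
    (t * b) *: delta_mx 0 k + ((t * a) *: delta_mx 0 i + x).
  by rewrite scalerDr !scalerA addrAC [RHS]addrC -addrA [x + _]addrC.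
have -> : t^-1 * (f ((t * b) *: delta_mx 0 k + ((t * a) *: delta_mx 0 i + x)) - f x) =
   a * pderiv i f (s1 *: delta_mx 0 i + x) +
   b * pderiv k f (s2 *: delta_mx 0 k + ((t * a) *: delta_mx 0 i + x)).
  rewrite -[X in t^-1 * X](subrKA (f ((t * a) *: delta_mx 0 i + x))) E1 E2 /pderiv.
  by field; rewrite gt_eqF.
set p1 := pderiv i f (_ + _) in d1 *; set p2 := pderiv k f (_ + _) in d2 *.
rewrite (_ : _ - _ = a * (pderiv i f x - p1) + b * (pderiv k f x - p2)); last by ring.
apply: le_lt_trans (ler_normD _ _) _; rewrite !normrM.
apply: (@le_lt_trans _ _ ((`|a| + `|b|) * (e / c))).
  by rewrite mulrDl lerD// ler_wpM2l// ltW.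
by rewrite mulrA ltr_pdivrMr// [ltRHS]mulrC ltr_pM2r// /c; lra.
Unshelve. all: by end_near. Qed.

Lemma cvg_sumr (T : Type) (F : set_system T) (FF : Filter F) (I : Type)
    (s : seq I) (f : I -> T -> R) (l : I -> R) :
  (forall i, f i t @[t --> F] --> l i) ->
  \sum_(i <- s) f i t @[t --> F] --> \sum_(i <- s) l i.
Proof.
move=> fl; elim: s => [|i s IH].
  rewrite big_nil (_ : (fun t => _) = cst 0); first exact: cvg_cst.
  by apply/funext => t; rewrite big_nil.
rewrite big_cons (_ : (fun t => _) = (fun t => f i t + \sum_(j <- s) f j t)).
  exact: (@cvgD _ R^o _ F FF (f i)).
by apply/funext => t; rewrite big_cons.
Qed.

(** The cone is cut out by non-strict inequalities between continuous functions of the entries,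
    hence is closed. This carries membership from difference quotients to derivatives. *)
Lemma in_cone_lim (T : topologicalType) (F : set_system T) (FF : ProperFilter F) c
    (M : T -> 'M[R]_n) (L : 'M[R]_n) :
  (forall i j, M t i j @[t --> F] --> L i j) ->
  (\forall t \near F, in_cone c (M t)) -> in_cone c L.
Proof.
move=> ML Mc.
have ctr : `|\tr (M t)| @[t --> F] --> `|\tr L|.
  by apply: (@cvg_norm _ R^o); apply: cvg_sumr => i; exact: ML.
have cq v : `|qform (M t) v| @[t --> F] --> `|qform L v|.
  apply: (@cvg_norm _ R^o); under eq_fun do rewrite qformE; rewrite qformE.
  apply: cvg_sumr => i; apply: (@cvgM _ _ F FF (fun=> v 0 i)); first exact: cvg_cst.
  apply: cvg_sumr => j; apply: (@cvgM _ _ F FF (fun t => M t i j) (fun=> v 0 j)).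
    exact: ML.
  exact: cvg_cst.
split=> [i j|v].
  apply: (@ler_cvg_to _ F FF R (fun t => `|M t i j|) (fun t => `|\tr (M t)|)) => //.
    by apply: (@cvg_norm _ R^o); exact: ML.
  by apply: filterS Mc => t [].
apply: (@ler_cvg_to _ F FF R (fun t => c * `|\tr (M t)| * sqn v) (fun t => `|qform (M t) v|)) => //.
  apply: (@cvgM _ _ F FF _ (fun=> sqn v)); last exact: cvg_cst.
  by apply: (@cvgM _ _ F FF (fun=> c)); [exact: cvg_cst|].
by apply: filterS Mc => t [].
Qed.

Lemma in_coneZ c (a : R) (A : 'M[R]_n) : in_cone c A -> in_cone c (a *: A).
Proof.
move=> [H1 H2]; split=> [i j|v].
  by rewrite mxE linearZ/= !normrM ler_wpM2l.
have -> : qform (a *: A) v = a * qform A v.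
  by rewrite /qform -scalemxAr -scalemxAl mxE.
rewrite linearZ/= !normrM.
rewrite (_ : c * _ * _ = `|a| * (c * `|\tr A| * sqn v)); last by ring.
by rewrite ler_wpM2l// H2.
Qed.

Lemma in_cone_tr0 c (A : 'M[R]_n) : in_cone c A -> \tr A = 0 -> A = 0.
Proof.
move=> [H _] A0; apply/matrixP => i j; rewrite mxE; apply/eqP.
by have := H i j; rewrite A0 normr0 normr_le0.
Qed.

(* All directional derivatives at a zero lie in the cone, whose elements of
   zero trace vanish; so they are proportional, [L_i = xi_i L]. The equation
   becomes [xi H L = 0] with [L] nondegenerate. *)
Lemma gradient_eq0 (U : set 'rV[R]_n) (A : 'rV[R]_n -> 'M[R]_n) (c : R)
    (H : 'M[R]_n) x :
  open U -> U x -> 0 < c -> (forall j k, Ck 1 U (fun y => A y j k)) ->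
  (forall y, U y -> in_cone c (A y)) -> A x = 0 -> H \in unitmx ->
  (forall k, \sum_i \sum_j H i j * pderiv i (fun y => A y j k) x = 0) ->
  forall i j k, pderiv i (fun y => A y j k) x = 0.
Proof.
move=> oU Ux c0 A_C1 A_cone Ax HU HL.
pose L i : 'M[R]_n := \matrix_(j, k) pderiv i (fun y => A y j k) x.
have cone2 a b i k : in_cone c (a *: L i + b *: L k).
  apply: (@in_cone_lim _ (0^'+) _ c (fun t : R => t^-1 *:
     A (t *: (a *: delta_mx 0 i + b *: delta_mx 0 k) + x))).
    move=> j l; rewrite !mxE.
    have := @cvg_two_directions U (fun y => A y j l) x i k a b oU (A_C1 j l) Ux.
    rewrite (_ : (fun t => t^-1 * _) = (fun t : R => (t^-1 *:
        A (t *: (a *: delta_mx 0 i + b *: delta_mx 0 k) + x)) j l)) //.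
    by apply/funext => t; rewrite Ax !mxE subr0.
  suff : \forall t \near 0^'+, U (t *: (a *: delta_mx 0 i + b *: delta_mx 0 k) + x).
    by apply: filterS => t Ut; apply: in_coneZ; exact: A_cone.
  have ct : (fun t : R => t *: (a *: delta_mx 0 i + b *: delta_mx 0 k) + x) @ 0^'+ --> x.
    rewrite -[X in _ --> X]add0r -(scale0r (a *: delta_mx 0 i + b *: delta_mx 0 k)).
    apply: cvgD; last exact: cvg_cst.
    by apply: cvgZr_tmp; apply: cvg_at_right_filter; exact: cvg_id.
  by apply: ct; exact: open_nbhs_nbhs.
have coneL i : in_cone c (L i).
  by have := cone2 1 0 i i; rewrite scale1r scale0r addr0.
suff trL k : \tr (L k) = 0.
  move=> i j k; have /matrixP/(_ j k) := in_cone_tr0 (coneL i) (trL i).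
  by rewrite !mxE.
apply/eqP; apply: contraT => trk.
have prop i : \tr (L k) *: L i = \tr (L i) *: L k.
  apply/eqP; rewrite -subr_eq0 -scaleNr; apply/eqP.
  apply: in_cone_tr0 (cone2 _ _ _ _) _.
  by rewrite linearD/= !linearZ/= mulNr mulrC subrr.
pose xi : 'rV[R]_n := \row_i \tr (L i).
have xiHL : xi *m H *m L k = 0.
  apply/rowP => l; rewrite !mxE.
  transitivity (\tr (L k) * \sum_i \sum_j H i j * pderiv i (fun y => A y j l) x).
    rewrite mulr_sumr (eq_bigr (fun j => \sum_i xi 0 i * H i j * L k j l)).
      rewrite exchange_big; apply: eq_bigr => i _ /=; rewrite mulr_sumr.
      apply: eq_bigr => j _.
      have /matrixP/(_ j l) := prop i; rewrite !mxE => Ei.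
      by rewrite mulrCA Ei; ring.
    by move=> j _; rewrite mxE mulr_suml.
  by rewrite HL mulr0.
have [_ /(_ (xi *m H))] := coneL k.
rewrite /qform xiHL mul0mx mxE normr0.
rewrite pmulr_rle0; last by rewrite mulr_gt0// normr_gt0.
move=> s0; have /sqn_eq0 xH : sqn (xi *m H) = 0.
  by apply/eqP; rewrite eq_le s0 sqn_ge0.
have : xi = 0 by rewrite -(mulmxK HU xi) xH mul0mx.
by move=> /rowP/(_ k); rewrite !mxE => /eqP; rewrite (negPf trk).
Qed.

End gradient.

(** * Unique continuation for the positive part *)

Section dominated.
Context {R : realType} {T : topologicalType}.
Implicit Types (p : T) (f g u : T -> R).

(** This is [f = O(u)] at [p]; with [u = 1] it is local boundedness. *)
Definition dominated p u f : Prop :=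
  exists2 K : R, 0 <= K & \forall x \near p, `|f x| <= K * u x.

Lemma near_bounded p f : {for p, continuous f} ->
  \forall x \near p, `|f x| <= `|f p| + 1.
Proof.
move=> cf.
have cn : {for p, continuous (fun x => `|f x|)} by exact: (@cvg_norm _ R^o).
have np : \forall x \near p, `|f x| < `|f p| + 1.
  by apply: (@cvgr_lt R _ _ _ (fun x => `|f x|) _ cn); rewrite ltrDl.
by apply: filterS np => x /ltW.
Qed.

Lemma continuous_dominated p f : {for p, continuous f} -> dominated p (fun=> 1) f.
Proof.
move=> /near_bounded H; exists (`|f p| + 1); first by rewrite addr_ge0.
by apply: filterS H => x; rewrite mulr1.
Qed.

Lemma dominated_near p u f g : (\forall x \near p, f x = g x) ->
  dominated p u f -> dominated p u g.
Proof.
by move=> fg [K K0 H]; exists K => //; apply: filterS2 fg H => x ->.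
Qed.

Lemma dominated_add p u f g : dominated p u f -> dominated p u g ->
  dominated p u (fun x => f x + g x).
Proof.
move=> [K K0 Hf] [L L0 Hg]; exists (K + L); first exact: addr_ge0.
apply: filterS2 Hf Hg => x fx gx.
by rewrite (le_trans (ler_normD _ _))// mulrDl lerD.
Qed.

Lemma dominated_mul p u f g : {for p, continuous f} -> dominated p u g ->
  dominated p u (fun x => f x * g x).
Proof.
move=> /near_bounded Hf [K K0 Hg]; exists ((`|f p| + 1) * K).
  by rewrite mulr_ge0// addr_ge0.
by apply: filterS2 Hf Hg => x fx gx; rewrite normrM -mulrA ler_pM.
Qed.

Lemma dominated_mulr p u f g : {for p, continuous f} -> dominated p u g ->
  dominated p u (fun x => g x * f x).
Proof.
by move=> cf dg; under eq_fun do rewrite mulrC; exact: dominated_mul.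
Qed.

Lemma dominated_sum p u (I : Type) (s : seq I) (f : I -> T -> R) :
  (forall i, dominated p u (f i)) -> dominated p u (fun x => \sum_(i <- s) f i x).
Proof.
move=> fu; elim: s => [|i s IH].
  exists 0 => //; apply: nearW => x.
  by rewrite big_nil normr0 mul0r.
under eq_fun do rewrite big_cons; exact: dominated_add.
Qed.

Lemma dominated_unif p u (I : finType) (f : I -> T -> R) : (forall x, 0 <= u x) ->
  (forall i, dominated p u (f i)) ->
  exists2 K : R, 0 <= K & \forall x \near p, forall i, `|f i x| <= K * u x.
Proof.
move=> u0 fu.
have /choice[K HK] : forall i, exists K : R, 0 <= K /\ \forall x \near p, `|f i x| <= K * u x.
  by move=> i; have [K K0 H] := fu i; exists K.
exists (\sum_i K i); first by apply: sumr_ge0 => i _; have [] := HK i.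
apply: filter_forall => i; have [_] := HK i; apply: filterS => x.
move=> /le_trans; apply; rewrite ler_wpM2r//.
by rewrite (bigD1 i)//= lerDl sumr_ge0// => j _; have [] := HK j.
Qed.

End dominated.

(** * The truncated tensor in a coordinate domain *)

Section local.
Context {R : realType} {n : nat}.
Variables (U : set 'rV[R]_n) (G E : 'rV[R]_n -> 'M[R]_n).
Variables (Gam : 'I_n -> 'I_n -> 'I_n -> 'rV[R]_n -> R) (c : R) (p : 'rV[R]_n).
Hypotheses (n0 : (0 < n)%N) (oU : open U) (Up : U p) (c0 : 0 < c).
Hypothesis G_sym : forall x, U x -> (G x)^T = G x.
Hypothesis G_pos : forall x, U x -> posdef (G x).
Hypothesis G_C1 : forall i j, Ck 1 U (fun x => G x i j).
Hypothesis E_C1 : forall i j, Ck 1 U (fun x => E x i j).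
Hypothesis E_cone : forall x, U x -> in_cone c (E x).
Hypothesis E_ge0 : forall x, U x -> 0 < \tr (E x) -> forall v, 0 <= qform (E x) v.
Hypothesis Gam_cont : forall l i j x, U x -> {for x, continuous (Gam l i j)}.
Hypothesis E_div : forall x k, U x ->
  \sum_i \sum_j invmx (G x) i j * (pderiv i (fun y => E y j k) x
    - \sum_l Gam l i j x * E x l k - \sum_l Gam l i k x * E x j l) = 0.

Let tau x := \tr (E x).
Let H x := invmx (G x).
Let Ep i j := pos_restr tau (fun x => E x i j).
Let u := pos_restr tau tau.
(** [P] is E+ with both indices raised by the inverse metric, and [u], the positive part of the
    coordinate trace of [E], measures its size. These are the data fed into
    [weak_unique_continuation]. *)
Let P x : 'M[R]_n := \matrix_(i, j) \sum_b (\sum_a H x i a * Ep a b x) * H x b j.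

Let u_ge0 x : 0 <= u x.
Proof. by rewrite /u /pos_restr; case: ifP => // /ltW. Qed.

Let H_C1 i j : Ck 1 U (fun x => H x i j).
Proof. by apply: Ck1_invmx => // x Ux; apply: posdef_unitmx; exact: G_pos. Qed.

Let tau_C1 : Ck 1 U tau.
Proof. by apply: Ck1_sum => // i; exact: E_C1. Qed.

Let cont f x : Ck 1 U f -> U x -> {for x, continuous f}.
Proof. by move=> /Ck1P Hf /Hf[]. Qed.

Let contd f x i : Ck 1 U f -> U x -> {for x, continuous (pderiv i f)}.
Proof. by move=> /Ck1P Hf /Hf[_ /(_ i)[]]. Qed.

Let E_eq0 x : U x -> tau x = 0 -> E x = 0.
Proof. by move=> Ux; apply: in_cone_tr0; exact: E_cone. Qed.

(** Where the trace vanishes so does [E]; the Christoffel terms of [E_div] then drop out, leaving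
    the algebraic equation of [gradient_eq0]. *)
Let dE_eq0 x i j k : U x -> tau x = 0 -> pderiv k (fun y => E y i j) x = 0.
Proof.
move=> Ux t0; have Ex := E_eq0 Ux t0.
apply: (gradient_eq0 oU Ux c0 E_C1 E_cone Ex (H := H x)).
  by rewrite unitmx_inv posdef_unitmx//; exact: G_pos.
move=> l; rewrite -[RHS](E_div l Ux); apply: eq_bigr => a _; apply: eq_bigr => b _.
congr (_ * _); rewrite [X in _ - X - _]big1 ?[X in _ - X]big1 ?subr0//.
  by move=> d _; rewrite Ex mxE mulr0.
by move=> d _; rewrite Ex mxE mulr0.
Qed.

Let Ep_C1 i j : Ck 1 U (Ep i j).
Proof.
apply: (Ck1_pos_restr oU (E_C1 i j)) => x Ux; first exact: (cont tau_C1 Ux).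
move=> t0; rewrite (E_eq0 Ux t0) mxE; split=> [//|k].
exact: (dE_eq0 i j k Ux t0).
Qed.

Let pderiv_Ep i j k x : U x -> pderiv k (Ep i j) x =
  if 0 < tau x then pderiv k (fun y => E y i j) x else 0.
Proof.
move=> Ux; have /Ck1P/(_ _ Ux)[_ /(_ k)[d _]] := E_C1 i j.
have [|_] // := is_derive_pos_restr (cont tau_C1 Ux) d _.
by move=> t0; rewrite E_eq0// mxE; split=> //; exact: dE_eq0.
Qed.

Let Ep_dominated i j : dominated p u (Ep i j).
Proof.
exists 1 => //; apply: filterS (open_nbhs_nbhs (conj oU Up)) => x Ux.
rewrite mul1r /u /Ep /pos_restr; case: ifP => t0; last by rewrite normr0.
by have [Hc _] := E_cone Ux; have := Hc i j; rewrite (gtr0_norm t0).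
Qed.

Let P_C1 i j : Ck 1 U (fun x => P x i j).
Proof.
under eq_fun do rewrite mxE.
apply: (Ck1_sum oU) => b; apply: (Ck1_mul oU _ (H_C1 b j)).
by apply: (Ck1_sum oU) => a; exact: (Ck1_mul oU (H_C1 i a) (Ep_C1 a b)).
Qed.

Let pderiv_P i j x : U x -> pderiv i (fun y => P y i j) x =
  \sum_b ((\sum_a H x i a * Ep a b x) * pderiv i (fun y => H y b j) x +
    H x b j * \sum_a (H x i a * pderiv i (Ep a b) x + Ep a b x * pderiv i (fun y => H y i a) x)).
Proof.
move=> Ux; under [X in pderiv i X]eq_fun do rewrite mxE.
have dsum b := is_derive_sumf (index_enum 'I_n) (fun a => is_derive_mul
  (Ck1_is_derive (H_C1 i a) i Ux) (Ck1_is_derive (Ep_C1 a b) i Ux)).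
by have [] := is_derive_sumf (index_enum 'I_n) (fun b => is_derive_mul
  (dsum b) (Ck1_is_derive (H_C1 b j) i Ux)).
Qed.

(** Where the trace is positive this is [E_div] rearranged; elsewhere the truncated components and
    their derivatives are all zero. *)
Let divE_Ep b x : U x -> \sum_i \sum_a H x i a * pderiv i (Ep a b) x =
  \sum_i \sum_a H x i a * (\sum_l Gam l i a x * Ep l b x + \sum_l Gam l i b x * Ep a l x).
Proof.
move=> Ux; have [t0|t0] := ltP 0 (tau x); last first.
  have Ep0 a d : Ep a d x = 0 by rewrite /Ep /pos_restr ltNge t0.
  rewrite [LHS]big1 ?[RHS]big1// => i _; rewrite big1// => a _.
    by rewrite !big1 ?addr0 ?mulr0// => l _; rewrite Ep0 mulr0.
  by rewrite pderiv_Ep// ltNge t0 mulr0.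
have EpE a d : Ep a d x = E x a d by rewrite /Ep /pos_restr t0.
apply/eqP; rewrite -subr_eq0 -[X in _ == X](E_div b Ux) -sumrB; apply/eqP.
apply: eq_bigr => i _; rewrite -sumrB; apply: eq_bigr => a _.
rewrite pderiv_Ep// t0 -mulrBr opprD addrA; congr (_ * (_ - _ - _)).
  by apply: eq_bigr => l _; rewrite EpE.
by apply: eq_bigr => l _; rewrite EpE.
Qed.

(** By the product rule, derivatives of E+ enter only through its contracted divergence, which
    [divE_Ep] turns into zeroth-order terms. What remains ([W]) is a sum of continuous coefficients
    times components of E+, each of which is O([u]). *)
Let divP_dominated j : dominated p u (fun x => \sum_i pderiv i (fun y => P y i j) x).
Proof.
pose W x :=
  \sum_i \sum_b (\sum_a H x i a * Ep a b x) * pderiv i (fun y => H y b j) x +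
  (\sum_b H x b j * \sum_i \sum_a H x i a *
      (\sum_l Gam l i a x * Ep l b x + \sum_l Gam l i b x * Ep a l x) +
   \sum_b H x b j * \sum_i \sum_a Ep a b x * pderiv i (fun y => H y i a) x).
have cH i k : {for p, continuous (fun x => H x i k)} by exact: cont.
have cdH l i k : {for p, continuous (pderiv l (fun x => H x i k))} by exact: contd.
have cG l i k : {for p, continuous (Gam l i k)} by exact: Gam_cont.
apply: (@dominated_near _ _ p u W).
  apply: filterS (open_nbhs_nbhs (conj oU Up)) => x Ux; rewrite /W.
  rewrite [RHS](eq_bigr _ (fun i _ => pderiv_P i j Ux)).
  under [RHS]eq_bigr do rewrite big_split/=; rewrite big_split/=; congr (_ + _).
  rewrite [RHS]exchange_big/= -big_split/=; apply: eq_bigr => b _.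
  rewrite -mulr_sumr -mulrDr; congr (_ * _).
  rewrite -divE_Ep// -big_split/=; apply: eq_bigr => i _.
  by rewrite -big_split.
apply: dominated_add; last apply: dominated_add.
- apply: dominated_sum => i; apply: dominated_sum => b; apply: dominated_mulr => //.
  by apply: dominated_sum => a; exact: dominated_mul.
- apply: dominated_sum => b; apply: dominated_mul => //.
  apply: dominated_sum => i; apply: dominated_sum => a; apply: dominated_mul => //.
  by apply: dominated_add; apply: dominated_sum => l; exact: dominated_mul.
- apply: dominated_sum => b; apply: dominated_mul => //.
  apply: dominated_sum => i; apply: dominated_sum => a; exact: dominated_mulr.
Qed.

Let trP_dominated : dominated p u (fun x => \tr (P x)).
Proof.
rewrite /mxtrace; apply: dominated_sum => i; under eq_fun do rewrite mxE.
have cH j k : {for p, continuous (fun x => H x j k)} by exact: cont.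
apply: dominated_sum => b; apply: dominated_mulr => //.
by apply: dominated_sum => a; exact: dominated_mul.
Qed.

Let qform_P x w : U x ->
  qform (P x) w = if 0 < tau x then qform (E x) (w *m H x) else 0.
Proof.
move=> Ux; pose Ex : 'M[R]_n := \matrix_(a, b) Ep a b x.
have -> : P x = H x *m Ex *m H x.
  apply/matrixP => i j; rewrite !mxE; apply: eq_bigr => b _; rewrite mxE.
  by congr (_ * _); apply: eq_bigr => a _; rewrite mxE.
have -> : qform (H x *m Ex *m H x) w = qform Ex (w *m H x).
  rewrite /qform trmx_mul !mulmxA; congr ((_ *m _ *m _ *m _) _ _).
  by rewrite /H trmx_inv G_sym.
case: ifP => t0.
  by congr qform; apply/matrixP => a b; rewrite mxE /Ep /pos_restr t0.
rewrite (_ : Ex = 0) ?/qform ?mulmx0 ?mul0mx ?mxE//.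
by apply/matrixP => a b; rewrite !mxE /Ep /pos_restr t0.
Qed.

(** Where the trace is positive, [P] at [w] is [E] at [w H], bounded below by the cone condition;
    elsewhere both sides are zero. Since [w = (w H) G] and the entries of [G] are bounded near [p],
    the lengths of [w H] and [w] are comparable. *)
Let P_ge : exists2 a, 0 < a &
  \forall x \near p, forall w, a * u x * sqn w <= qform (P x) w.
Proof.
have [h h0 hP] : exists2 h : R, 0 <= h & \forall x \near p,
    forall ij : 'I_n * 'I_n, `|G x ij.1 ij.2| <= h * 1.
  apply: (dominated_unif (u := fun=> 1)) => // -[i j] /=.
  by apply: continuous_dominated; exact: cont.
pose k := (h + 1) ^+ 2 * n%:R ^+ 2.
have k0 : 0 < k by rewrite mulr_gt0// exprn_gt0// ?ltr0n// ltr_wpDl.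
exists (c / k); first by rewrite divr_gt0.
apply: filterS2 (open_nbhs_nbhs (conj oU Up)) hP => x Ux hx w.
rewrite qform_P// /u /pos_restr; case: ifP => t0; last by rewrite mulr0 mul0r.
rewrite -[leRHS]ger0_norm; last exact: E_ge0.
have [_ /(_ (w *m H x)) Hc] := E_cone Ux; apply: le_trans Hc.
rewrite (gtr0_norm t0).
have GU : G x \in unitmx by apply: posdef_unitmx; exact: G_pos.
have sw : sqn w <= k * sqn (w *m H x).
  rewrite -{1}(mulmxKV GU w); apply: sqn_mulmx_le.
    by rewrite addr_ge0.
  by move=> i j; have := hx (i, j); rewrite mulr1 /=; lra.
rewrite (_ : c / k * tau x * sqn w = c * tau x * (k^-1 * sqn w)); last by ring.
rewrite ler_wpM2l//; first by rewrite mulr_ge0// ltW.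
by rewrite mulrC ler_pdivrMr// mulrC.
Qed.

(** All constants in the hypotheses of [weak_unique_continuation] are uniform near [p], so the
    radius of the ball of vanishing does not depend on the centre [x0], and a centre close enough to
    [p] has [p] well inside its ball. *)
Lemma local_unique_continuation : exists2 r : R, 0 < r &
  forall x0, `|x0 - p| < r -> (\forall y \near x0, \tr (E y) <= 0) ->
  \forall y \near p, \tr (E y) <= 0.
Proof.
have [a a0 aP] := P_ge.
have [b1 b10 b1P] := trP_dominated.
have [b2 b20 b2P] := dominated_unif u_ge0 divP_dominated.
pose N := [set x | [/\ U x, (forall w, a * u x * sqn w <= qform (P x) w),
  `|\tr (P x)| <= b1 * u x & forall j, `|\sum_i pderiv i (fun y => P y i j) x| <= b2 * u x]].
have nN : nbhs p N.
  have H12 : \forall x \near p, `|\tr (P x)| <= b1 * u x /\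
      forall j, `|\sum_i pderiv i (fun y => P y i j) x| <= b2 * u x.
    exact: filterI b1P b2P.
  by apply: filterS3 (open_nbhs_nbhs (conj oU Up)) aP H12 => x ? ? [? ?]; split.
move: nN => /nbhs_ballP[d /= d0 dN].
have dU : ball p d `<=` U by move=> x /dN[].
pose rho := d / 2.
have rho0 : 0 < rho by rewrite divr_gt0.
have n1 : 1 <= n%:R :> R by rewrite ler1n.
(* Points within [r] of [p] are within [2 * r = rho / (n + 1)] of [x0] in sup norm, so their squared
   Euclidean distance to [x0] is at most [n * rho^2 / (n + 1)^2 < rho^2]. Also [r <= rho / 2] keeps
   the cube around [x0] inside the ball of radius [d = 2 * rho]. *)
pose r := rho / (2 * (n%:R + 1)).
have r0 : 0 < r by rewrite divr_gt0// mulr_gt0// ltr_wpDl.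
have rr : 2 * r = rho / (n%:R + 1) by rewrite /r; field; rewrite gt_eqF// ltr_wpDl.
have rrho : 2 * r <= rho.
  by rewrite rr ler_pdivrMr ?ltr_wpDl// ler_peMr ?ltW//; lra.
exists r => // x0 x0p tx0.
have Qd : [set x | `|x - x0| <= rho] `<=` ball p d.
  move=> x /= xx0; rewrite -ball_normE /= distrC.
  rewrite -(subrKA x0) (le_lt_trans (ler_normD _ _))//.
  by move: xx0 x0p rrho; rewrite /rho; lra.
have oB : open (ball p d) by exact: ball_open.
have ux0 : \forall y \near x0, u y = 0.
  by apply: filterS tx0 => y ty; rewrite /u /pos_restr ltNge /tau ty.
move: ux0 => /nbhs_ballP[e /= e0 eP].
suff tauP y : `|y - p| < r -> \tr (E y) <= 0.
  apply/nbhs_ballP; exists r => //= y; rewrite -ball_normE /= distrC; exact: tauP.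
move=> yp.
suff : u y = 0.
  by rewrite /u /pos_restr; case: ltP => // t0 t1; rewrite t1 ltxx in t0.
(* The sum [b1 + b2] serves for both upper bounds, and squared Euclidean distance below [e ^+ 2]
   implies sup distance below [e]. *)
apply: (@weak_unique_continuation R n (ball p d) x0 P u a (b1 + b2) rho (e ^+ 2)) => //.
- exact: exprn_gt0.
- exact: addr_ge0.
- by move=> i j; apply: Ck1_sub dU _; exact: P_C1.
- by move=> x w /dN[].
- move=> x /dN[_ _ H1 _]; apply: le_trans (ler_norm _) (le_trans H1 _).
  by rewrite ler_wpM2r// lerDl.
- move=> x j /dN[_ _ _ H2]; apply: le_trans (H2 j) _.
  by rewrite ler_wpM2r// lerDr.
- move=> x _ xe; apply: eP; rewrite -ball_normE /= distrC.
  exact: norm_le_sqn.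
have yx0 : `|y - x0| < rho / (n%:R + 1).
  rewrite -rr -(subrKA p) (le_lt_trans (ler_normD _ _))// [X in _ + X]distrC.
  by lra.
apply: (@le_lt_trans _ _ (n%:R * (rho / (n%:R + 1)) ^+ 2)).
  have -> : n%:R * (rho / (n%:R + 1)) ^+ 2 = \sum_(i < n) (rho / (n%:R + 1)) ^+ 2.
    by rewrite sumr_const card_ord mulr_natl.
  apply: ler_sum => i _; rewrite -expr2 -[leLHS]real_normK ?num_real//.
  have yi := le_trans (coord_le_norm _ i) (ltW yx0).
  by rewrite ler_pXn2r// nnegrE// (le_trans _ yi).
rewrite expr_div_n mulrCA gtr_pMr ?exprn_gt0//.
rewrite ltr_pdivrMr ?exprn_gt0 ?ltr_wpDl// mul1r; nra.
Qed.

End local.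

(** * Connectedness *)

Section definite.
Context {R : realType} {n : nat}.
Implicit Types (A G : 'M[R]_n).

Lemma posdef_trace_gt0 A : (0 < n)%N -> posdef A -> 0 < \tr A.
Proof.
move=> n0 pA; have d0 i : 0 < A i i.
  rewrite -qform_delta; apply: pA; apply/eqP => /rowP/(_ i).
  by rewrite !mxE !eqxx/= => /eqP; rewrite oner_eq0.
rewrite /mxtrace (bigD1 (Ordinal n0))//= ltr_wpDr ?d0//.
by apply: sumr_ge0 => i _; exact: ltW.
Qed.

Lemma negdef_trace_lt0 A : (0 < n)%N -> negdef A -> \tr A < 0.
Proof.
by move=> n0 /(posdef_trace_gt0 n0); rewrite linearN/= oppr_gt0.
Qed.

Lemma cond_numberN G A : cond_number G (- A) = cond_number G A.
Proof.
have sub B : abs_eigenvalues G B `<=` abs_eigenvalues G (- B).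
  move=> _ [mu /eigenvalueP[v vB v0] <-]; exists (- mu); last by rewrite normrN.
  by apply/eigenvalueP; exists v => //; rewrite mulNmx mulmxN vB scaleNr.
rewrite /cond_number (_ : abs_eigenvalues G (- A) = abs_eigenvalues G A)//.
by apply/seteqP; split => //; rewrite -{2}(opprK A); exact: sub.
Qed.

End definite.

(** * From charts to the manifold *)

Section manifold.
Context {R : realType} {n : nat} {M : manifold R n}.
Variables (g E : tensor2 M).
Hypothesis n_gt0 : (0 < n)%N.
Hypothesis g_metric : riemannian_metric g.
Hypothesis E_sym : tensor_sym E.
Hypothesis E_C1 : tensor_Ck 1 E.
Hypothesis E_div : div_free g E.
Hypothesis E_sign : forall p : M, posdef_at E p \/ negdef_at E p \/ zero_at E p.
Hypothesis E_cond : forall K : set M, compact K ->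
  exists C : R, forall p : M, K p -> ~ zero_at E p -> cond_le_at g E p C.

Section in_chart.
Variable c : chart R n M.
Hypothesis ac : atlas c.

Let img := Defs.coord c @` dom c.

Lemma in_imgP x : img x -> dom c (param c x) /\ Defs.coord c (param c x) = x.
Proof. by move=> [q dq <-]; rewrite paramK. Qed.

Lemma E_sign_chart q : dom c q ->
  [\/ posdef (E c q), negdef (E c q) | E c q = 0].
Proof.
move=> dq; have [H|[H|H]] := E_sign q; have := H c ac dq.
- by move=> ?; exact: Or31.
- by move=> ?; exact: Or32.
- by move=> ?; exact: Or33.
Qed.

Lemma trace_gt0P q : dom c q -> 0 < \tr (E c q) <-> posdef (E c q).
Proof.
move=> dq; split; last exact: posdef_trace_gt0.
have [//|/(negdef_trace_lt0 n_gt0) t0|->] := E_sign_chart dq.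
  by move=> /(lt_trans t0); rewrite ltxx.
by rewrite mxtrace0 ltxx.
Qed.

(** [E_sign] decides between its three cases in all charts at once, so the trace in a single chart
    already identifies the case. *)
Lemma posdef_atP q : dom c q -> posdef_at E q <-> 0 < \tr (E c q).
Proof.
move=> dq; split=> [H|]; first by apply/(trace_gt0P dq); exact: H.
have [//|[H|H]] := E_sign q; have := H c ac dq.
  by move=> /(negdef_trace_lt0 n_gt0) t0 /(lt_trans t0); rewrite ltxx.
by move=> ->; rewrite mxtrace0 ltxx.
Qed.

(** On a compact coordinate cube the condition number, the inverse metric and the trace of the
    metric are bounded, so [posdef_in_cone] applies, to [E] or to [- E], with one constant. *)
Lemma in_cone_near x : img x -> exists2 k : R, 0 < k &
  exists2 r : R, 0 < r & forall y, `|y - x| < r ->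
    img y /\ in_cone k (E c (param c y)).
Proof.
move=> Ix; have [g_sym g_Ck g_pos] := g_metric.
have oI : open img by exact: img_open.
have pG y : img y -> posdef (g c (param c y)).
  by move=> /in_imgP[d _]; exact: g_pos.
have gC1 i j : Ck 1 img (fun y => g c (param c y) i j) by exact: g_Ck.
have H_C1 i j : Ck 1 img (fun y => invmx (g c (param c y)) i j).
  by apply: (Ck1_invmx oI) => // y Iy; apply: posdef_unitmx; exact: pG.
have tr_C1 : Ck 1 img (fun y => \tr (g c (param c y))).
  by apply: (Ck1_sum oI) => i; exact: gC1.
have ct f : Ck 1 img f -> {for x, continuous f} by move=> /Ck1P/(_ _ Ix)[].
have [h h0 hP] : exists2 h : R, 0 <= h & \forall y \near x,
    forall ij : 'I_n * 'I_n, `|invmx (g c (param c y)) ij.1 ij.2| <= h * 1.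
  apply: (dominated_unif (u := fun=> 1)) => // -[i j] /=.
  by apply: continuous_dominated; apply: ct; exact: H_C1.
have := near_bounded (ct _ tr_C1); set t := _ + 1 => tP.
have t0 : 0 < t by rewrite ltr_wpDl.
have : nbhs x [set y | [/\ img y, forall i j, `|invmx (g c (param c y)) i j| <= h
    & \tr (g c (param c y)) <= t]].
  apply: filterS3 (open_nbhs_nbhs (conj oI Ix)) hP tP => y Iy hy ty; split => //.
    by move=> i j; have := hy (i, j); rewrite mulr1.
  exact: le_trans (ler_norm _) ty.
move=> /nbhs_ballP[d /= d0 dP].
have {}dP y : `|y - x| <= d / 2 -> [/\ img y,
    forall i j, `|invmx (g c (param c y)) i j| <= h & \tr (g c (param c y)) <= t].
  by move=> yx; apply: dP; rewrite -ball_normE /= distrC (le_lt_trans yx)//; lra.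
(* [E_cond] concerns compact subsets of the manifold, so the closed cube is pushed forward by
   [param]. *)
have cK : compact (param c @` [set y | `|y - x| <= d / 2]).
  apply: continuous_compact; last exact: compact_closed_ball_row.
  apply: continuous_in_subspaceT => y; rewrite inE => /dP[Iy _ _].
  exact: param_cont.
have [C0 C0P] := E_cond cK.
pose C := `|C0| + 1.
have C_gt0 : 0 < C by rewrite ltr_wpDl.
(* By [qform_le] this bounds the form of the inverse metric, so its inverse bounds the metric from
   below; the 1 keeps it positive. *)
pose kk := (h + 1) * n%:R.
have kk0 : 0 < kk by rewrite mulr_gt0 ?ltr0n// ltr_wpDl.
exists (kk^-1 / (C * t)); first by rewrite divr_gt0 ?invr_gt0// mulr_gt0.
exists (d / 2); first by rewrite divr_gt0.
move=> y /ltW yx; have [Iy hy ty] := dP _ yx; split => //.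
have [dq _] := in_imgP Iy; set q := param c y in hy ty dq *.
have [E0|E0] := pselect (E c q = 0); first by rewrite E0; exact: in_cone0.
have cq : cond_number (g c q) (E c q) <= C.
  apply: le_trans (_ : C0 <= C); last by rewrite (le_trans (ler_norm _))// lerDl.
  by apply: C0P => //; [exists y|move=> /(_ c ac dq)].
have sG : (g c q)^T = g c q by exact: g_sym.
have sE : (E c q)^T = E c q by exact: E_sym.
have pq : posdef (g c q) by exact: g_pos.
have kG v : kk^-1 * sqn v <= qform (g c q) v.
  apply: qform_ge_of_inv => // w.
  apply: le_trans (qform_le w h0 hy) _.
  by rewrite ler_wpM2r ?sqn_ge0// ler_wpM2r// lerDl.
have [pE|nE|//] := E_sign_chart dq.
  by apply: (posdef_in_cone n_gt0 sE sG pq pE cq C_gt0 _ t0 kG ty); rewrite invr_gt0.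
have sNE : (- E c q)^T = - E c q by rewrite linearN/= sE.
rewrite -cond_numberN in cq.
apply: in_coneN.
by apply: (posdef_in_cone n_gt0 sNE sG pq nE cq C_gt0 _ t0 kG ty); rewrite invr_gt0.
Qed.

Lemma continuous_christoffel l i j x : img x ->
  {for x, continuous (christoffel g c l i j)}.
Proof.
move=> Ix; have [g_sym g_Ck g_pos] := g_metric.
have oI : open img by exact: img_open.
have gC1 a b : Ck 1 img (local_comp g c a b) by exact: g_Ck.
have cd a b k : {for x, continuous (pderiv k (local_comp g c a b))}.
  by have /Ck1P/(_ _ Ix)[_ /(_ k)[]] := gC1 a b.
have cH a b : {for x, continuous (ginv g c a b)}.
  suff /Ck1P/(_ _ Ix)[] : Ck 1 img (ginv g c a b) by [].
  apply: (@Ck1_invmx _ _ _ oI _ (fun y => g c (param c y))) => // y /in_imgP[d _].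
  by apply: posdef_unitmx; exact: g_pos.
apply: (@continuousM _ _ (fun=> 2^-1) (fun x => \sum_m ginv g c l m x *
    (pderiv i (local_comp g c j m) x + pderiv j (local_comp g c i m) x
     - pderiv m (local_comp g c i j) x))); first exact: cst_continuous.
apply: continuous_sum => m.
apply: (@continuousM _ _ (ginv g c l m) (fun x => pderiv i (local_comp g c j m) x +
  pderiv j (local_comp g c i m) x - pderiv m (local_comp g c i j) x)) => //.
apply: (@continuousB _ R^o _ (fun x => pderiv i (local_comp g c j m) x +
  pderiv j (local_comp g c i m) x)) => //.
exact: (@continuousD _ R^o _ (pderiv i (local_comp g c j m))).
Qed.

Lemma chart_unique_continuation x : img x -> exists2 r : R, 0 < r &
  forall x0, `|x0 - x| < r ->
  (\forall y \near x0, \tr (E c (param c y)) <= 0) ->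
  \forall y \near x, \tr (E c (param c y)) <= 0.
Proof.
move=> Ix; have [g_sym g_Ck g_pos] := g_metric.
have [k k0 [r r0 rP]] := in_cone_near Ix.
have bP y : ball x r y -> img y /\ in_cone k (E c (param c y)).
  by rewrite -ball_normE /= distrC; exact: rP.
have bI : ball x r `<=` img by move=> y /bP[].
apply: (@local_unique_continuation _ _ (ball x r) (fun y => g c (param c y))
  (fun y => E c (param c y)) (christoffel g c) k x) => //.
- exact: ball_open.
- exact: ballxx.
- by move=> y /bI/in_imgP[d _]; exact: g_sym.
- by move=> y /bI/in_imgP[d _]; exact: g_pos.
- by move=> i j; apply: (Ck1_sub bI); exact: g_Ck.
- by move=> i j; apply: (Ck1_sub bI); exact: E_C1.
- by move=> y /bP[].
- move=> y /bI/in_imgP[d _] /(trace_gt0P d) pE v; exact: posdef_qform_ge0.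
- by move=> l i j y /bI; exact: continuous_christoffel.
- move=> y a /bI/in_imgP[d e].
  by have := E_div ac d a; rewrite e.
Qed.

End in_chart.

(** The interior of the zero set of E+, hence open by construction. *)
Definition nowhere_posdef_near : set M :=
  [set p | \forall q \near p, ~ posdef_at E q].

Lemma closed_nowhere_posdef_near : closed nowhere_posdef_near.
Proof.
move=> p clp; have [c ac dp] := atlas_cover p.
have Ip : (Defs.coord c @` dom c) (Defs.coord c p) by exists p.
have [r r0 rP] := chart_unique_continuation ac Ip.
have ndom q : dom c q -> \forall q' \near q, dom c q'.
  by move=> dq; apply: open_nbhs_nbhs; split => //; exact: dom_open.
have nb : nbhs p (dom c `&` [set q | `|Defs.coord c q - Defs.coord c p| < r]).
  apply: filterI; first exact: ndom.
  have cc : Defs.coord c @ p --> Defs.coord c p := coord_cont dp.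
  have cb : \forall q \near p, ball (Defs.coord c p) r (Defs.coord c q).
    by apply: cc; exact: nbhsx_ballx.
  by apply: filterS cb => q /=; rewrite -ball_normE /= distrC.
(* A limit point [p] has a point [p0] of the set within the radius [r] attached to [p]; as [r] works
   for every such centre, vanishing near [p0] spreads to a neighbourhood of [p]. *)
have [p0 [p0W [dp0 p0r]]] := clp _ nb.
have Ip0 : (Defs.coord c @` dom c) (Defs.coord c p0) by exists p0.
have pc : param c @ Defs.coord c p0 --> p0.
  by rewrite -{2}(paramK dp0); exact: param_cont.
have nI : \forall y \near Defs.coord c p0, (Defs.coord c @` dom c) y.
  by apply: open_nbhs_nbhs; split => //; exact: img_open.
have nW : \forall y \near Defs.coord c p0, ~ posdef_at E (param c y).
  exact: pc _ p0W.
have nt : \forall y \near Defs.coord c p0, \tr (E c (param c y)) <= 0.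
  apply: filterS2 nI nW => y /in_imgP[d _] nE; rewrite leNgt; apply/negP => t0.
  by apply: nE; apply/(posdef_atP ac d).
have := rP _ p0r nt => tp.
have cc : Defs.coord c @ p --> Defs.coord c p := coord_cont dp.
have tp' : \forall q \near p, \tr (E c (param c (Defs.coord c q))) <= 0.
  exact: cc _ tp.
apply: filterS2 (ndom _ dp) tp' => q dq.
rewrite paramK// leNgt => /negP t0; apply: contra_not t0.
by move=> /(posdef_atP ac dq).
Qed.

Lemma negdef_nowhere_posdef_near q : negdef_at E q -> nowhere_posdef_near q.
Proof.
move=> nq; have [c ac dq] := atlas_cover q.
have Iq : (Defs.coord c @` dom c) (Defs.coord c q) by exists q.
have tr_C1 : Ck 1 (Defs.coord c @` dom c) (fun y => \tr (E c (param c y))).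
  have oI : open (Defs.coord c @` dom c) by exact: img_open.
  by apply: (Ck1_sum oI) => i; exact: E_C1.
have /Ck1P/(_ _ Iq)[ct _] := tr_C1.
have tq : \tr (E c (param c (Defs.coord c q))) < 0.
  by rewrite paramK//; apply: negdef_trace_lt0 => //; exact: nq.
have nt : \forall y \near Defs.coord c q, \tr (E c (param c y)) < 0.
  exact: (@cvgr_lt R _ _ _ (fun y => \tr (E c (param c y))) _ ct).
have cc : Defs.coord c @ q --> Defs.coord c q := coord_cont dq.
have ndom : \forall q' \near q, dom c q'.
  by apply: open_nbhs_nbhs; split => //; exact: dom_open.
have nt' : \forall q' \near q, \tr (E c (param c (Defs.coord c q'))) < 0.
  exact: cc _ nt.
apply: filterS2 ndom nt' => q' dq'.
rewrite paramK// => t0 /(posdef_atP ac dq') t1.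
by have := lt_trans t0 t1; rewrite ltxx.
Qed.

Lemma not_both_signs : connected [set: M] -> forall p q : M,
  posdef_at E p -> negdef_at E q -> False.
Proof.
move=> cM p q pp nq.
have WT : nowhere_posdef_near = [set: M].
  apply: cM; first by exists q; exact: negdef_nowhere_posdef_near.
    exists nowhere_posdef_near; last by rewrite setTI.
    exact: open_interior.
  exists nowhere_posdef_near; last by rewrite setTI.
  exact: closed_nowhere_posdef_near.
have : nowhere_posdef_near p by rewrite WT.
by move=> /nbhs_singleton; apply.
Qed.

End manifold.

(** In dimension 0 all coordinates coincide, so a chart domain is a single point; singletons are
    therefore open, and also closed. *)
Lemma connected_manifold0 (R : realType) (M : manifold R 0) :
  connected [set: M] -> forall p q : M, p = q.
Proof.
move=> cM p q.
have o1 (a : M) : open [set a].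
  have [c _ da] := atlas_cover a.
  rewrite (_ : [set a] = dom c); first exact: dom_open.
  apply/seteqP; split=> [_ ->//|b db].
  rewrite /= -(paramK da) -(paramK db); congr (param c _).
  by apply/rowP => -[].
have : [set p] = [set: M].
  apply: cM; first by exists p.
    by exists [set p]; rewrite ?setTI.
  exists [set p]; rewrite ?setTI//.
  rewrite -openC (_ : ~` [set p] = \bigcup_(a in ~` [set p]) [set a]).
    by apply: bigcup_open => a _.
  by rewrite bigcup_imset1 image_id.
by move=> /seteqP[_ /(_ q I)] ->.
Qed.

Theorem theorem1p4 (R : realType) (n : nat) (M : manifold R n)
    (g E : tensor2 M)
    (M_connected : connected [set: M])
    (g_metric : riemannian_metric g)
    (E_sym : tensor_sym E)
    (E_C1 : tensor_Ck 1 E)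
    (E_div : div_free g E)
    (E_sign : forall p : M, posdef_at E p \/ negdef_at E p \/ zero_at E p)
    (E_cond : forall K : set M, compact K ->
      exists C : R, forall p : M, K p -> ~ zero_at E p -> cond_le_at g E p C) :
  ~ (exists p q : M, p <> q /\ posdef_at E p /\ negdef_at E q).
Proof.
(* For [n = 0] the empty matrix is both positive and negative definite, and the contradiction comes
   from [p <> q] instead. *)
move=> [p [q [pq [pE nE]]]]; case: (posnP n) => [n0|n0].
  by subst n; apply: pq; exact: connected_manifold0.
exact: (not_both_signs n0 g_metric E_sym E_C1 E_div E_sign E_cond M_connected pE nE).
Qed.
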